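(* Let $G=\{G_n\}_{n\in\mathbb{N}}$ be an ordered mean. Let $\mathbf{A}\in\mathbb{P}^n$, $\omega\in\Delta_n$ and $\lambda=(\lambda_1,\dots,\lambda_k)\in\Delta_k$. Then for all $\mu_1,\dots,\mu_k>0$ and $-1\le p\le1\le q$, $$G^{P_q(\lambda;\mu_1,\dots,\mu_k)}(\omega;\mathbf{A})\ge P_p(\lambda;G^{\mu_1}(\omega;\mathbf{A}),\dots,G^{\mu_k}(\omega;\mathbf{A})),$$ where, for $q\ge1$, $P_q(\lambda;\mu_1,\dots,\mu_k)=\left(\sum_{i=1}^k\lambda_i\mu_i^q\right)^{1/q}$.
   Context: Let $\mathcal{H}$ be a Hilbert space and $\mathbb{P}$ the open convex cone of positive invertible bounded linear operators on $\mathcal{H}$; $I$ is the identity. For self-adjoint $A,B$, $A\le B$ means $B-A$ is positive semi-definite (Loewner order). $\Delta_n$ is the set of probability vectors $\omega=(w_1,\dots,w_n)\in\mathbb{R}^n$ with all $w_i>0$ and $\sum_i w_i=1$. An ordered mean is a family $G=\{G_n\}_{n\in\mathbb{N}}$ of maps $G_n:\Delta_n\times\mathbb{P}^n\to\mathbb{P}$ such that for every $n$, all $\mathbf{A},\mathbf{B}\in\mathbb{P}^n$, $\omega\in\Delta_n$ and real $a>0$: (P1) $G_n(\omega;a\mathbf{A})=aG_n(\omega;\mathbf{A})$; (P2) $G_n(\omega;\mathbf{B})\le G_n(\omega;\mathbf{A})$ whenever $B_i\le A_i$ for all $i$; (P3) $G_n(\omega;(1-s)\mathbf{A}+s\mathbf{B})\ge(1-s)G_n(\omega;\mathbf{A})+sG_n(\omega;\mathbf{B})$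 for $0\le s\le1$; (P4) $\left[\sum_{i=1}^n w_iA_i^{-1}\right]^{-1}\le G_n(\omega;\mathbf{A})\le\sum_{i=1}^n w_iA_i$. Parameterized ordered mean: for real $\mu\ge0$ and $\mathbf{A}\in\mathbb{P}^n$, $G^\mu(\omega;\mathbf{A})=G_n^\mu(\omega;\mathbf{A}):=G_n(\omega;A_1+\mu I,\dots,A_n+\mu I)-\mu I$ (an element of $\mathbb{P}$). Power means: $A\#_pB=A^{1/2}(A^{-1/2}BA^{-1/2})^pA^{1/2}$. For $\lambda\in\Delta_k$ and $X_1,\dots,X_k\in\mathbb{P}$: for $p\in(0,1]$, $P_p(\lambda;X_1,\dots,X_k)$ is the unique solution $X\in\mathbb{P}$ of $X=\sum_{i=1}^k\lambda_i\,X\#_pX_i$; for $p\in[-1,0)$, $P_p(\lambda;X_1,\dots,X_k)=P_{-p}(\lambda;X_1^{-1},\dots,X_k^{-1})^{-1}$; and $P_0(\lambda;X_1,\dots,X_k)=\Lambda(\lambda;X_1,\dots,X_k)$ is the Karcher mean, the unique solution $X\in\mathbb{P}$ of $\sum_{i=1}^k\lambda_i\log(X^{1/2}X_i^{-1}X^{1/2})=0$. *)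

(* Defs.v *)
From HB Require Import structures.
From mathcomp Require Import all_boot all_order all_algebra.
From mathcomp Require Import complex.
From mathcomp Require Import all_classical all_reals all_analysis.

Set Implicit Arguments.
Unset Strict Implicit.
Unset Printing Implicit Defensive.

Import Order.TTheory GRing.Theory Num.Theory.
Import numFieldNormedType.Exports.
Import ComplexField.

Local Open Scope classical_set_scope.
Local Open Scope ring_scope.
Local Open Scope complex_scope.

(* A complex Hilbert space is a complete normed module [H] over [R[i]] together
   with a positive definite Hermitian form [dot] (linear in its first argument)
   inducing the norm.  Operators are bare functions [H -> H], with the pointwise
   module structure of functions, composition [\o] as product and [idfun] as
   identity operator. *)

Definition hilbert_dot (R : realType) (H : completeNormedModType R[i])
    (dot : {dot H for Num.conj}) : Prop :=
  forall x : H, `|x| ^+ 2 = dot x x.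

Section BoundedOperators.
Context {R : realType} {H : completeNormedModType R[i]}.
Implicit Types (A B X : H -> H) (f : R -> R) (p : {poly R}).

(* [opnorm_le A c] : the operator norm of [A] is at most [c]. *)
Definition opnorm_le A (c : R) : Prop := forall x : H, `|A x| <= c%:C * `|x|.

Definition bounded_op A : Prop := linear A /\ exists c : R, opnorm_le A c.

Definition is_inverse A B : Prop :=
  [/\ bounded_op B, A \o B = idfun & B \o A = idfun].

Definition invertible_op A : Prop := exists B, is_inverse A B.

(* The inverse when it exists, the zero operator otherwise. *)
Definition op_inv A : H -> H := xget 0 [set B | is_inverse A B].

Definition spectrum A : set R[i] :=
  [set z | ~ invertible_op (A - z *: idfun)].

Definition poly_op p A : H -> H := \sum_(i < size p) (p`_i)%:C *: iter i A.

(* Continuous functional calculus [f(A)] of a self-adjoint operator [A]: the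
   norm limit of [p(A)] for real polynomials [p] converging to [f] uniformly on
   the spectrum of [A], which is real. *)
Definition is_fun_calc f A B : Prop :=
  bounded_op B /\
  forall e : R, 0 < e -> exists p,
    (forall t : R, spectrum A t%:C -> `|p.[t] - f t| <= e) /\
    opnorm_le (poly_op p A - B) e.

Definition fun_calc f A : H -> H := xget 0 [set B | is_fun_calc f A B].

Definition op_pow A (r : R) : H -> H := fun_calc (fun t => t `^ r) A.

Definition op_log A : H -> H := fun_calc (@ln R) A.

(* A #_p B *)
Definition wgeo_mean (p : R) A B : H -> H :=
  op_pow A (1 / 2) \o
  op_pow (op_pow A (- (1 / 2)) \o B \o op_pow A (- (1 / 2))) p \o
  op_pow A (1 / 2).

Definition prob_vec (n : nat) (w : 'I_n -> R) : Prop :=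
  (forall i, 0 < w i) /\ \sum_(i < n) w i = 1.

End BoundedOperators.

Section OrderedMeans.
Context {R : realType} {H : completeNormedModType R[i]}.
Variable dot : {dot H for (@Num.conj R[i])}.
Implicit Types A B X : H -> H.

Definition selfadjoint A : Prop := forall x y, dot (A x) y = dot x (A y).

Definition positive_op A : Prop :=
  [/\ bounded_op A, selfadjoint A & forall x, 0 <= dot (A x) x].

Definition pos_cone A : Prop := positive_op A /\ invertible_op A.

Definition loewner_le A B : Prop := positive_op (B - A).

(* P_p for 0 < p.  The equations defining [power_mean_pos] and [karcher_mean]
   have a unique solution in the cone, so the default value of [xget] is only a
   junk value outside the domain of the means. *)
Definition power_mean_pos (p : R) (k : nat) (lam : 'I_k -> R)
    (Xs : 'I_k -> H -> H) : H -> H :=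
  xget 0 [set X | pos_cone X /\
                  X = \sum_(i < k) (lam i)%:C *: wgeo_mean p X (Xs i)].

Definition karcher_mean (k : nat) (lam : 'I_k -> R) (Xs : 'I_k -> H -> H) :
    H -> H :=
  xget 0 [set X | pos_cone X /\
    \sum_(i < k) (lam i)%:C *:
      op_log (op_pow X (1 / 2) \o op_inv (Xs i) \o op_pow X (1 / 2)) = 0].

Definition power_mean (p : R) (k : nat) (lam : 'I_k -> R)
    (Xs : 'I_k -> H -> H) : H -> H :=
  if 0 < p then power_mean_pos p lam Xs
  else if p < 0 then
    op_inv (power_mean_pos (- p) lam (fun i => op_inv (Xs i)))
  else karcher_mean lam Xs.

Record ordered_mean
    (G : forall n : nat, ('I_n -> R) -> ('I_n -> H -> H) -> H -> H) : Prop := {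
  om_pos : forall n (w : 'I_n -> R) (A : 'I_n -> H -> H),
    prob_vec w -> (forall i, pos_cone (A i)) -> pos_cone (G n w A);
  om_homogeneous : forall n (w : 'I_n -> R) (A : 'I_n -> H -> H) (a : R),
    prob_vec w -> (forall i, pos_cone (A i)) -> 0 < a ->
    G n w (fun i => a%:C *: A i) = a%:C *: G n w A;
  om_monotone : forall n (w : 'I_n -> R) (A B : 'I_n -> H -> H),
    prob_vec w -> (forall i, pos_cone (A i)) -> (forall i, pos_cone (B i)) ->
    (forall i, loewner_le (B i) (A i)) -> loewner_le (G n w B) (G n w A);
  om_concave : forall n (w : 'I_n -> R) (A B : 'I_n -> H -> H) (s : R),
    prob_vec w -> (forall i, pos_cone (A i)) -> (forall i, pos_cone (B i)) ->
    0 <= s -> s <= 1 ->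
    loewner_le ((1 - s)%:C *: G n w A + s%:C *: G n w B)
               (G n w (fun i => (1 - s)%:C *: A i + s%:C *: B i));
  om_harmonic_le : forall n (w : 'I_n -> R) (A : 'I_n -> H -> H),
    prob_vec w -> (forall i, pos_cone (A i)) ->
    loewner_le (op_inv (\sum_(i < n) (w i)%:C *: op_inv (A i))) (G n w A);
  om_le_arithmetic : forall n (w : 'I_n -> R) (A : 'I_n -> H -> H),
    prob_vec w -> (forall i, pos_cone (A i)) ->
    loewner_le (G n w A) (\sum_(i < n) (w i)%:C *: A i)
}.

End OrderedMeans.

(* G^mu *)
Definition param_mean (R : realType) (H : completeNormedModType R[i])
    (G : forall n : nat, ('I_n -> R) -> ('I_n -> H -> H) -> H -> H)
    (mu : R) (n : nat) (w : 'I_n -> R) (A : 'I_n -> H -> H) : H -> H :=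
  G n w (fun i => A i + mu%:C *: idfun) - mu%:C *: idfun.

Definition real_power_mean (R : realType) (q : R) (k : nat)
    (lam mu : 'I_k -> R) : R :=
  (\sum_(i < k) lam i * mu i `^ q) `^ (1 / q).

(* Main.v *)
(* The map mu |-> G^mu is monotone and concave: homogeneity and concavity make G
   superadditive, and G fixes scalar operators from below, so that
   G(A + nu) >= G(A + mu) + (nu - mu) I.  Hence
     G^(P_q(mu)) >= G^(P_1(mu)) >= sum_i lam_i G^(mu_i),
   and it remains to bound P_p by the arithmetic mean.  Evaluating the equation
   that defines P_p against the tangent bounds
     t^p <= (1 - p) + p t,  t^p >= 1 + p (1 - 1/t),  ln t >= 1 - 1/t
   gives this bound directly for p > 0, p < 0 and p = 0 respectively.

   The continuous functional calculus rests on one fact: if A is self-adjoint and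
   a real polynomial p is nonnegative on the spectrum of A, then p(A) >= 0.
   Indeed the infimum m of the quadratic form of p(A) lies in the spectrum of
   p(A), and factoring p - m over the complex numbers yields a point t of the
   spectrum of A, necessarily real, with p(t) = m. *)
Require Import Defs.
From mathcomp Require Import all_boot all_order all_algebra.
From mathcomp Require Import complex.
From mathcomp Require Import all_classical all_reals all_analysis.
From mathcomp Require Import ring lra.

Import Order.TTheory GRing.Theory Num.Theory.
Import numFieldNormedType.Exports.

Local Open Scope ring_scope.
Local Open Scope complex_scope.
Set Implicit Arguments.
Unset Strict Implicit.

(** * Real inner products and norms *)

Section RealInnerProduct.
Context {R : realType} {H : completeNormedModType R[i]}.
Variable dot : {dot H for (@Num.conj R[i])}.
Implicit Types (x y z : H) (A B P Q : H -> H).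

(** Operator inequalities are read throughout as inequalities between the real forms [rdot (A x) x].
    The bound of [P_p] by the arithmetic mean succeeds because the tangents are taken at [t = 1] and
    the unknown [X] occurs on both sides of its equation: once the weights are summed, the constant
    terms become multiples of the form of [X], and a positive multiple of the claim remains. For the
    Karcher equation, whose right side is [0], the claim comes out directly. The obstacle is to test
    the equation at vectors where the conjugating square roots of [X] cancel. The upper tangent
    bound is tested at [y], the square root of [X] applied to [x]. The lower bounds contain [1 / t];
    multiplied by [t^2] they become polynomial, and they are tested at a vector [v] that the
    conjugated operator [C] sends to [y]. The functional calculus thus has to provide order bounds,
    products of two functions that form a polynomial, and uniform approximation on compact intervals
    of positive reals, where powers and the logarithm are Lipschitz. *)

Definition rdot x y : R := complex.Re (dot x y).

Let ReD (a b : R[i]) : complex.Re (a + b) = complex.Re a + complex.Re b.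
Proof. by case: a b => ? ? []. Qed.

Let ReN (a : R[i]) : complex.Re (- a) = - complex.Re a.
Proof. by case: a. Qed.

Let Re_conj (a : R[i]) : complex.Re (Num.conj a) = complex.Re a.
Proof. by case: a. Qed.

Let ReZ (a : R) (b : R[i]) : complex.Re (a%:C * b) = a * complex.Re b.
Proof. by case: b => c d /=; rewrite mul0r subr0. Qed.

Let Re_mul_conj_i (a : R[i]) : complex.Re (Num.conj 'i * a) = complex.Im a.
Proof. by case: a => a b /=; rewrite !mul0r mulN1r opprK add0r. Qed.

Let Im_conj_fix (a : R[i]) : a = Num.conj a -> complex.Im a = 0.
Proof. by case: a => a b [] /eqP; rewrite -subr_eq0 opprK -mulr2n mulrn_eq0 => /eqP. Qed.

Lemma rdotDl x y z : rdot (x + y) z = rdot x z + rdot y z.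
Proof. by rewrite /rdot linearDl; exact: ReD. Qed.

Lemma rdotC x y : rdot x y = rdot y x.
Proof. by rewrite /rdot hermC expr0 mul1r Re_conj. Qed.

Lemma rdotDr x y z : rdot x (y + z) = rdot x y + rdot x z.
Proof. by rewrite rdotC rdotDl !(rdotC x). Qed.

Lemma rdotZl (a : R) x y : rdot (a%:C *: x) y = a * rdot x y.
Proof. by rewrite /rdot linearZl_LR; exact: ReZ. Qed.

Lemma rdotZr (a : R) x y : rdot x (a%:C *: y) = a * rdot x y.
Proof. by rewrite rdotC rdotZl rdotC. Qed.

Lemma rdotNl x y : rdot (- x) y = - rdot x y.
Proof. by rewrite /rdot linearNl; exact: ReN. Qed.

Lemma rdotNr x y : rdot x (- y) = - rdot x y.
Proof. by rewrite rdotC rdotNl rdotC. Qed.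

Lemma rdot0l x : rdot 0 x = 0.
Proof. by rewrite /rdot linear0l. Qed.

Lemma rdot0r x : rdot x 0 = 0.
Proof. by rewrite rdotC rdot0l. Qed.

Definition rdotE := (rdotDl, rdotDr, rdotZl, rdotZr, rdotNl, rdotNr, rdot0l, rdot0r).

Lemma rdot_suml (I : finType) (F : I -> H) y :
  rdot (\sum_i F i) y = \sum_i rdot (F i) y.
Proof.
apply: (big_morph (fun x => rdot x y)) => [x z|]; first exact: rdotDl.
exact: rdot0l.
Qed.

Lemma dot_selfE x : dot x x = (rdot x x)%:C.
Proof.
by rewrite /rdot [RHS](RRe_real (ger0_real _)) //; exact: (dnorm_ge0 dot x).
Qed.

Lemma rdot_ge0 x : 0 <= rdot x x.
Proof. by rewrite -ler0c -dot_selfE; exact: dnorm_ge0. Qed.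

Lemma rdot_eq0 x : rdot x x = 0 -> x = 0.
Proof. by move=> x0; apply/eqP; rewrite -(dnorm_eq0 dot) dot_selfE x0. Qed.

Lemma rdot_i x y : rdot x ('i *: y) = complex.Im (dot x y).
Proof. by rewrite /rdot linearZr_LR; exact: Re_mul_conj_i. Qed.

(** The imaginary part of [dot x y] is [rdot x ('i *: y)], so symmetry of the real form, used at
    ['i *: y] as well, recovers the complex identity. *)
Lemma selfadjointP A : linear A ->
  selfadjoint dot A <-> forall x y, rdot (A x) y = rdot x (A y).
Proof.
move=> Al; split=> [As x y|As x y]; first by rewrite /rdot As.
apply/eqP; rewrite eq_complex; apply/andP; split; apply/eqP; first exact: As.
have AZ (u : H) : A ('i *: u) = 'i *: A u.
  by have := Al 'i u 0; rewrite addr0 => ->; have := Al 1 0 0;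
     rewrite !scale1r !addr0 => /esym/eqP; rewrite -subr_eq0 addrK => /eqP->;
     rewrite addr0.
by rewrite -!rdot_i -AZ As.
Qed.

(** The order on [R[i]] also demands a vanishing imaginary part; symmetry makes [dot (A x) x] its
    own conjugate, so only the real part is left to sign. *)
Lemma positive_opP A : positive_op dot A <->
  [/\ bounded_op A, forall x y, rdot (A x) y = rdot x (A y)
     & forall x, 0 <= rdot (A x) x].
Proof.
split=> -[Ab As Ap]; split=> //; have /selfadjointP S := Ab.1.
- exact/S.
- by move=> x; move: (Ap x); rewrite lecE => /andP[].
- exact/S.
move=> x; rewrite lecE; apply/andP; split; last exact: Ap.
rewrite (@Im_conj_fix (dot (A x) x)) //.
have /S /(_ x x) e := As.
by rewrite {1}e hermC expr0 mul1r.
Qed.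

Hypothesis hdot : hilbert_dot dot.

Definition nrm x : R := Num.sqrt (rdot x x).

Lemma nrm_ge0 x : 0 <= nrm x. Proof. exact: sqrtr_ge0. Qed.

Lemma nrm_sqr x : nrm x ^+ 2 = rdot x x.
Proof. by rewrite sqr_sqrtr // rdot_ge0. Qed.

Lemma normE x : `|x| = (nrm x)%:C.
Proof.
apply/eqP; rewrite -(@eqrXn2 _ 2) ?ler0c ?nrm_ge0 ?normr_ge0 //.
by rewrite hdot dot_selfE -nrm_sqr rmorphXn.
Qed.

Lemma opnorm_leP A (c : R) :
  opnorm_le A c <-> forall x, nrm (A x) <= c * nrm x.
Proof.
by split=> Ac x; move: (Ac x); rewrite !normE -rmorphM lecR.
Qed.

Lemma opnorm_sqrP A (c : R) : 0 <= c ->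
  opnorm_le A c <-> forall x, rdot (A x) (A x) <= c ^+ 2 * rdot x x.
Proof.
move=> c0; rewrite opnorm_leP; split=> Ac x; move: (Ac x).
  by rewrite -!nrm_sqr -exprMn; move=> h; rewrite lerXn2r // nnegrE ?mulr_ge0 ?nrm_ge0.
rewrite -!nrm_sqr -exprMn ler_pXn2r ?nnegrE ?mulr_ge0 ?nrm_ge0 //.
Qed.

Lemma nrmD x y : nrm (x + y) <= nrm x + nrm y.
Proof. by have := ler_normD x y; rewrite !normE -rmorphD lecR. Qed.

Lemma nrmN x : nrm (- x) = nrm x.
Proof. by rewrite /nrm !rdotE opprK. Qed.

Lemma nrmB x y : nrm (x - y) = nrm (y - x).
Proof. by rewrite -nrmN opprB. Qed.

Lemma nrm_le0 x : nrm x <= 0 -> x = 0.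
Proof.
move=> h; apply: rdot_eq0; rewrite -nrm_sqr.
suff -> : nrm x = 0 by rewrite expr0n.
by apply/le_anti; rewrite h nrm_ge0.
Qed.

Lemma rdot_le_nrm x y : rdot x y <= nrm x * nrm y.
Proof.
have h t : 0 <= rdot x x * t ^+ 2 - 2 * t * rdot x y + rdot y y.
  by have := rdot_ge0 (t%:C *: x - y); rewrite !rdotE (rdotC y x); lra.
have [x0|x0] := eqVneq (nrm x) 0.
  rewrite x0 mul0r.
  have -> : x = 0 by apply: nrm_le0; rewrite x0.
  by rewrite rdot0l.
have xp : 0 < nrm x by rewrite lt_def x0 nrm_ge0.
have [y0|y0] := eqVneq (nrm y) 0.
  have -> : y = 0 by apply: nrm_le0; rewrite y0.
  by rewrite rdot0r mulr_ge0 ?nrm_ge0.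
have yp : 0 < nrm y by rewrite lt_def y0 nrm_ge0.
(* This value of [t], rather than the minimiser of the quadratic, makes the two square terms equal,
   so that the difference to be signed factors out. *)
have := h (nrm y / nrm x); rewrite -!nrm_sqr.
have -> : nrm x ^+ 2 * (nrm y / nrm x) ^+ 2 - 2 * (nrm y / nrm x) * rdot x y +
  nrm y ^+ 2 = 2 * (nrm y / nrm x) * (nrm x * nrm y - rdot x y) by field.
by rewrite pmulr_rge0 ?subr_ge0 // !mulr_gt0 ?invr_gt0.
Qed.

(** Transfers completeness from the [R[i]]-valued norm to real tolerances, the form in which
    Richardson iteration and the functional calculus use it. *)
Lemma nrm_complete (u : nat -> H) :
  (forall e : R, 0 < e -> exists N : nat, forall n m : nat,
     (N <= n)%N -> (N <= m)%N -> nrm (u n - u m) <= e) ->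
  exists l, forall e : R, 0 < e -> exists N : nat, forall n : nat,
     (N <= n)%N -> nrm (u n - l) <= e.
Proof.
move=> uC.
have /cauchy_cvg /cvg_ex[l ul] : cauchy (u @ \oo)%classic.
  apply/cauchy_ballP => /= -[e e']; rewrite ltcE /= => /andP[/eqP -> e0].
  have [|N uN] := uC (e / 2); first by rewrite divr_gt0.
  exists (u @` [set n | (N <= n)%N], u @` [set n | (N <= n)%N])%classic.
    by split; exists N => // n Nn; exists n.
  move=> [_ _] /= [[n Nn <-] [m Nm <-]].
  rewrite -ball_normE /ball_ /= normE complexr0 ltcR (le_lt_trans (uN _ _ Nn Nm)) //.
  lra.
exists l => e e0.
have eC : (0 : R[i]) < e%:C by rewrite ltcR.
have /cvgrPdist_le /(_ _ eC) [N _ lN] := ul.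
by exists N => n /lN /=; rewrite normE lecR nrmB.
Qed.

End RealInnerProduct.

(** * Bounded and coercive operators *)

Section LinearMaps.
Context {K : nzRingType} {V W : lmodType K} {A : V -> W}.
Hypothesis Al : linear A.

Lemma lin0 : A 0 = 0.
Proof. by have := Al (-1) 0 0; rewrite scaler0 addr0 scaleN1r addNr. Qed.

Lemma linD x y : A (x + y) = A x + A y.
Proof. by have := Al 1 x y; rewrite !scale1r. Qed.

Lemma linZ a x : A (a *: x) = a *: A x.
Proof. by have := Al a x 0; rewrite lin0 !addr0. Qed.

Lemma linN x : A (- x) = - A x.
Proof. by rewrite -scaleN1r linZ scaleN1r. Qed.

Lemma linB x y : A (x - y) = A x - A y.
Proof. by rewrite linD linN. Qed.

End LinearMaps.

Section BoundedOperators.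
Context {R : realType} {H : completeNormedModType R[i]}.
Variable dot : {dot H for (@Num.conj R[i])}.
Hypothesis hdot : hilbert_dot dot.
Implicit Types (x y z : H) (A B P Q : H -> H).
Local Notation rd := (rdot dot).
Local Notation nm := (nrm dot).

Definition rsa A := forall x y, rd (A x) y = rd x (A y).

Lemma bounded_opP A : bounded_op A <->
  linear A /\ exists2 c : R, 0 < c & forall x, nm (A x) <= c * nm x.
Proof.
split=> -[Al [c]].
  move=> /(opnorm_leP hdot) Ac; split=> //; exists (`|c| + 1) => [|x].
    by rewrite ltr_wpDl.
  apply: (le_trans (Ac x)); apply: ler_wpM2r; first exact: nrm_ge0.
  by rewrite (le_trans (ler_norm c)) // lerDl.
by move=> c0 Ac; split=> //; exists c; apply/(opnorm_leP hdot).
Qed.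

Lemma bounded_id : bounded_op (idfun : H -> H).
Proof. by apply/bounded_opP; split=> //; exists 1 => // x; rewrite mul1r. Qed.

Lemma bounded0 : bounded_op (0 : H -> H).
Proof.
apply/bounded_opP; split=> [a x y|]; first by rewrite scaler0 addr0.
by exists 1 => // x; rewrite mul1r /nrm rdot0l sqrtr0 sqrtr_ge0.
Qed.

Lemma boundedD A B : bounded_op A -> bounded_op B -> bounded_op (A + B).
Proof.
move=> /bounded_opP[Al [a a0 Aa]] /bounded_opP[Bl [b b0 Bb]].
apply/bounded_opP; split=> [k x y|].
  by rewrite /= !fctE Al Bl scalerDr addrACA.
exists (a + b); first exact: addr_gt0.
by move=> x; rewrite fctE mulrDl (le_trans (nrmD hdot _ _)) // lerD.
Qed.

Lemma boundedN A : bounded_op A -> bounded_op (- A).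
Proof.
move=> /bounded_opP[Al [a a0 Aa]]; apply/bounded_opP; split=> [k x y|].
  by rewrite !fctE Al opprD scalerN.
by exists a => // x; rewrite fctE nrmN.
Qed.

Lemma boundedB A B : bounded_op A -> bounded_op B -> bounded_op (A - B).
Proof. by move=> Ab Bb; apply: boundedD => //; exact: boundedN. Qed.

Lemma bounded_comp A B : bounded_op A -> bounded_op B -> bounded_op (A \o B).
Proof.
move=> /bounded_opP[Al [a a0 Aa]] /bounded_opP[Bl [b b0 Bb]].
apply/bounded_opP; split=> [k x y|].
  by rewrite /= Bl Al.
exists (a * b); first exact: mulr_gt0.
by move=> x; rewrite /= (le_trans (Aa _)) // -mulrA ler_pM2l.
Qed.

Lemma boundedZ (k : R[i]) A : bounded_op A -> bounded_op (k *: A).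
Proof.
move=> [Al [c Ac]]; split=> [a x y|].
  by rewrite !fctE Al scalerDr !scalerA mulrC.
have e : `|k| = (complex.Re `|k|)%:C by rewrite RRe_real ?normr_real.
exists (complex.Re `|k| * c) => x; rewrite fctE normrZ rmorphM /= -e -mulrA.
exact: ler_wpM2l.
Qed.

Lemma bounded_sum (I : finType) (F : I -> H -> H) :
  (forall i, bounded_op (F i)) -> bounded_op (\sum_i F i).
Proof.
move=> Fb; apply: (big_ind (@bounded_op R H)) => //; first exact: bounded0.
by move=> A B; exact: boundedD.
Qed.

Lemma bounded_form A : bounded_op A ->
  exists2 M : R, 0 < M & forall x, `|rd (A x) x| <= M * rd x x.
Proof.
move=> /bounded_opP[Al [a a0 Aa]]; exists a => // x.
have h : nm (A x) * nm x <= a * rd x x.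
  by rewrite -nrm_sqr expr2 mulrA ler_wpM2r ?nrm_ge0.
rewrite ler_norml lerNl -rdotNl; apply/andP; split; apply: le_trans h.
  by rewrite -(nrmN dot (A x)) rdot_le_nrm.
exact: rdot_le_nrm.
Qed.

(** Positivity of [P] at [M%:C *: x - P x], combined with the upper bound at [P x], yields this
    operator inequality [P^2 <= M P] before any square root of [P] is available. *)
Lemma sq_le_form P (M : R) : linear P -> rsa P -> 0 < M ->
  (forall x, 0 <= rd (P x) x) -> (forall x, rd (P x) x <= M * rd x x) ->
  forall x, rd (P x) (P x) <= M * rd (P x) x.
Proof.
move=> Pl Ps M0 P0 PM x.
have := P0 (M%:C *: x - P x).
rewrite (linB Pl) (linZ Pl) !rdotE (Ps (P x) x).
have := PM (P x); set a := rd (P (P x)) (P x); set b := rd (P x) (P x).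
set c := rd (P x) x => h1 h2.
have : 0 <= M * (M * c - b) by lra.
by rewrite pmulr_rge0 // subr_ge0.
Qed.

(** Since [0 <= Q + e <= 2 e], [sq_le_form] gives [(Q + e)^2 <= 2 e (Q + e)], which simplifies to
    [Q^2 <= e^2]. *)
Lemma opnorm_le_form Q (e : R) : linear Q -> rsa Q -> 0 < e ->
  (forall x, `|rd (Q x) x| <= e * rd x x) -> opnorm_le Q e.
Proof.
move=> Ql Qs e0 Qe; apply/(opnorm_sqrP hdot Q (ltW e0)) => x.
have Qe' y : rd (Q y) y <= e * rd y y /\ - (e * rd y y) <= rd (Q y) y.
  by have := Qe y; rewrite ler_norml => /andP[].
pose P y := Q y + e%:C *: y.
have Pl : linear P by move=> k u v; rewrite /P Ql !scalerDr addrACA !scalerA mulrC.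
have e2 : 0 < 2 * e by rewrite mulr_gt0.
have /= := @sq_le_form P (2 * e) Pl _ e2 _ _ x; rewrite /P !rdotE (rdotC dot x (Q x)).
move=> h.
have {h} : rd (Q x) (Q x) + e * rd (Q x) x + (e * rd (Q x) x + e * (e * rd x x))
   <= 2 * e * (rd (Q x) x + e * rd x x).
  apply: le_trans (h _ _ _); first by lra.
  - by move=> u v; rewrite !rdotE Qs.
  - by move=> y; rewrite !rdotE; have := Qe' y; lra.
  - by move=> y; rewrite !rdotE; have := Qe' y; lra.
by lra.
Qed.

Lemma coercive_inverse A B (c : R) : bounded_op A -> 0 < c ->
  (forall x, c * rd x x <= rd (A x) x) ->
  (forall x, A (B x) = x) -> (forall x, B (A x) = x) -> is_inverse A B.
Proof.
move=> Ab c0 Ac AB BA; have Al := Ab.1.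
split; last by apply/funext => x; rewrite /= BA.
  apply/bounded_opP; split=> [k x y|].
    by rewrite -[RHS]BA Al !AB.
  exists c^-1; first by rewrite invr_gt0.
  move=> y; rewrite ler_pdivlMl //.
  have [n0|n0] := eqVneq (nm (B y)) 0; first by rewrite n0 mulr0 nrm_ge0.
  have np : 0 < nm (B y) by rewrite lt_def n0 nrm_ge0.
  rewrite -(ler_pM2r np) -mulrA -expr2 nrm_sqr.
  by apply: (le_trans (Ac _)); rewrite AB rdot_le_nrm.
by apply/funext => x; rewrite /= AB.
Qed.

(* Richardson iteration [u <- u - (P u - y) / M], a contraction of ratio
   [1 - c / M]. *)
Lemma coercive_surjective P (c : R) y : bounded_op P -> rsa P -> 0 < c ->
  (forall x, c * rd x x <= rd (P x) x) -> exists x, P x = y.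
Proof.
move=> Pb Ps c0 Pc.
have Pl : linear P := Pb.1.
have [M0 M00 PM0] := bounded_form Pb.
(* Adding [c] forces [c / M < 1], so that the ratio [q] lies strictly between 0 and 1. *)
pose M := M0 + c.
have Mp : 0 < M by rewrite addr_gt0.
have PM x : rd (P x) x <= M * rd x x.
  apply: (le_trans (ler_norm _)); apply: (le_trans (PM0 x)).
  by rewrite ler_wpM2r ?rdot_ge0 // lerDl ltW.
pose L x := x - (M^-1)%:C *: P x.
pose q := 1 - c / M.
have cM : c / M < 1 by rewrite ltr_pdivrMr // mul1r ltrDr.
have cM0 : 0 < c / M by rewrite divr_gt0.
have q0 : 0 < q by rewrite /q; lra.
have q1 : q < 1 by rewrite /q; lra.
have Ll : linear L.
  move=> k u v; rewrite /L Pl !scalerDr scalerN !scalerA opprD addrACA.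
  by rewrite (mulrC k).
have Lq : forall x, nm (L x) <= q * nm x.
  apply/(opnorm_leP hdot); apply: opnorm_le_form => // [u v|x].
    by rewrite /L !rdotE Ps.
  have Mi : M^-1 * (M * rd x x) = rd x x by rewrite mulKf // gt_eqF.
  have h1 : M^-1 * rd (P x) x <= rd x x by rewrite -[leRHS]Mi ler_pM2l ?invr_gt0.
  have h2 : c / M * rd x x <= M^-1 * rd (P x) x.
    by rewrite (mulrC c) -mulrA ler_pM2l ?invr_gt0.
  rewrite /L !rdotE /q ler_norml; apply/andP; split; last by lra.
  have := rdot_ge0 dot x => h3.
  have : 0 <= (1 - c / M) * rd x x by rewrite mulr_ge0 // subr_ge0 ltW.
  by lra.
pose y' := (M^-1)%:C *: y.
pose phi x := L x + y'.
have phiB x x' : nm (phi x - phi x') <= q * nm (x - x').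
  have -> : phi x - phi x' = L (x - x') by rewrite /phi opprD addrACA subrr addr0 (linB Ll).
  exact: Lq.
pose u n := iter n phi 0.
pose B := nm y' / (1 - q).
have q1' : 0 < 1 - q by lra.
have B0 : 0 <= B by rewrite divr_ge0 ?nrm_ge0 ?(ltW q1').
have uB n : nm (u n) <= B.
  elim: n => [|n IH] /=; first by rewrite /u /= /nrm rdot0l sqrtr0.
  rewrite /phi (le_trans (nrmD hdot _ _)) //.
  have -> : B = q * B + nm y' by rewrite /B; field; lra.
  by rewrite lerD2r (le_trans (Lq _)) // ler_pM2l.
have uN N n m : nm (u (N + n)%N - u (N + m)%N) <= q ^+ N * (2 * B).
  elim: N => [|N IH].
    rewrite expr0 mul1r (le_trans (nrmD hdot _ _)) // nrmN.
    by have := uB n; have := uB m; rewrite /=; lra.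
  rewrite !addSn /= (le_trans (phiB _ _)) //.
  by rewrite exprS -mulrA ler_pM2l.
have [l ul] : exists l, forall e : R, 0 < e -> exists N : nat, forall n : nat,
     (N <= n)%N -> nm (u n - l) <= e.
  apply: (nrm_complete hdot) => e e0.
  have /cvgrPdist_le : ((fun n => q ^+ n) @ \oo --> (0 : R))%classic.
    by apply: cvg_expr; rewrite ger0_norm // ltW.
  (* The extra 1 keeps the divisor positive when [B = 0]. *)
  have B1 : 0 < 2 * B + 1 by lra.
  have e1 : 0 < e / (2 * B + 1) by rewrite divr_gt0.
  move=> /(_ _ e1) [N _ qN]; exists N => n m Nn Nm.
  rewrite -(subnKC Nn) -(subnKC Nm); apply: (le_trans (uN _ _ _)).
  have := qN N (leqnn N); rewrite /= sub0r normrN ger0_norm ?(exprn_ge0 _ (ltW q0)) //.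
  rewrite ler_pdivlMr // => h; apply: le_trans h.
  by rewrite ler_wpM2l ?(exprn_ge0 _ (ltW q0)) //; lra.
exists l.
have phil : phi l = l.
  apply/eqP; rewrite -subr_eq0; apply/eqP; apply: (@nrm_le0 _ _ dot).
  apply/ler_addgt0Pl => e e0; rewrite addr0.
  have [N uNl] := ul (e / 2) (divr_gt0 e0 (ltr0Sn _ _)).
  have -> : phi l - l = (phi l - phi (u N)) + (u N.+1 - l).
    by rewrite addrA subrK.
  rewrite (le_trans (nrmD hdot _ _)) //.
  have := uNl N.+1 (leqnSn N).
  have := phiB l (u N); rewrite (nrmB dot l).
  have : q * nm (u N - l) <= nm (u N - l) by rewrite ler_piMl ?nrm_ge0 // ltW.
  have := uNl N (leqnn N); lra.
have : (M^-1)%:C *: (P l - y) = 0.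
  move: phil; rewrite /phi /L /y' -addrA -[X in _ = X]addr0 => /addrI.
  by rewrite scalerBr addrC => /eqP; rewrite subr_eq0 => /eqP ->; rewrite subrr.
move=> /eqP; rewrite scaler_eq0 => /orP[|]; last by rewrite subr_eq0 => /eqP.
by rewrite eq_complex /= eqxx andbT invr_eq0 gt_eqF.
Qed.

(** Coercivity also gives injectivity, so the right inverse chosen from surjectivity is
    two-sided. *)
Lemma coercive_invertible P (c : R) : bounded_op P -> rsa P -> 0 < c ->
  (forall x, c * rd x x <= rd (P x) x) -> invertible_op P.
Proof.
move=> Pb Ps c0 Pc; have Pl := Pb.1.
have /choice[B PB] y := coercive_surjective y Pb Ps c0 Pc.
exists B; apply: (coercive_inverse Pb c0) => // x.
apply/eqP; rewrite -subr_eq0; apply/eqP/(@rdot_eq0 _ _ dot)/le_anti.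
rewrite rdot_ge0 andbT.
by have := Pc (B (P x) - x); rewrite (linB Pl) PB subrr rdot0l pmulr_rle0.
Qed.

(** With [b] bounding the inverse and [M] bounding the form,
    [|x|^2 <= b^2 |P x|^2 <= b^2 M rd (P x) x], the last step by [sq_le_form]. *)
Lemma invertible_coercive P : bounded_op P -> rsa P ->
  (forall x, 0 <= rd (P x) x) -> invertible_op P ->
  exists2 c : R, 0 < c & forall x, c * rd x x <= rd (P x) x.
Proof.
move=> Pb Ps P0 [B [Bb _ BP]].
have [M M0 PM] := bounded_form Pb.
have /bounded_opP[_ [b b0 Bb']] := Bb.
exists (b ^+ 2 * M)^-1; first by rewrite invr_gt0 mulr_gt0 ?exprn_gt0.
move=> x; rewrite ler_pdivrMl ?mulr_gt0 ?exprn_gt0 //.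
have PM' y : rd (P y) y <= M * rd y y by apply: le_trans (PM y); rewrite ler_norm.
have h := sq_le_form Pb.1 Ps M0 P0 PM' x.
have /= := Bb' (P x); have /= -> := congr1 (fun f => f x) BP.
rewrite -(@ler_pXn2r _ 2) // ?nnegrE ?mulr_ge0 ?nrm_ge0 ?(ltW b0) // exprMn !nrm_sqr.
by move=> h2; apply: (le_trans h2); rewrite -[leRHS]mulrA ler_pM2l ?exprn_gt0.
Qed.

End BoundedOperators.

(** * Polynomials of operators and the spectrum *)

Section PolynomialCalculus.
Context {R : realType} {H : completeNormedModType R[i]}.
Implicit Types (x y : H) (A B P Q : H -> H) (p q : {poly R}) (f g : {poly R[i]}).

(** Complex coefficients allow a polynomial to be split into linear factors. *)
Definition cpoly_op f A : H -> H := \sum_(i < size f) f`_i *: iter i A.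

Lemma cpoly_op_widen (n : nat) f A : (size f <= n)%N ->
  cpoly_op f A = \sum_(i < n) f`_i *: iter i A.
Proof.
move=> fn; rewrite /cpoly_op (big_ord_widen n (fun i => f`_i *: iter i A)) //.
rewrite big_mkcond; apply: eq_bigr => i _; case: ltnP => // h.
by rewrite nth_default // scale0r.
Qed.

Lemma cpoly_opD f g A : cpoly_op (f + g) A = cpoly_op f A + cpoly_op g A.
Proof.
have fn : (size f <= maxn (size f) (size g))%N by rewrite leq_maxl.
have gn : (size g <= maxn (size f) (size g))%N by rewrite leq_maxr.
rewrite (cpoly_op_widen _ fn) (cpoly_op_widen _ gn).
rewrite (cpoly_op_widen _ (size_polyD f g)) -big_split /=.
by apply: eq_bigr => i _; rewrite coefD scalerDl.
Qed.

Lemma cpoly_opZ (a : R[i]) f A : cpoly_op (a *: f) A = a *: cpoly_op f A.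
Proof.
rewrite (cpoly_op_widen _ (size_scale_leq a f)) scaler_sumr.
by apply: eq_bigr => i _; rewrite coefZ scalerA.
Qed.

Lemma cpoly_opC (a : R[i]) A : cpoly_op a%:P A = a *: idfun.
Proof.
by rewrite (cpoly_op_widen _ (size_polyC_leq1 a)) big_ord1 coefC eqxx.
Qed.

Lemma cpoly_opMX f A : cpoly_op (f * 'X) A = cpoly_op f A \o A.
Proof.
rewrite (@cpoly_op_widen (size f).+1); last first.
  have [->|f0] := eqVneq f 0; first by rewrite mul0r size_poly0.
  by rewrite size_mulX.
rewrite big_ord_recl coefMX eqxx scale0r add0r.
apply/funext => x; rewrite /cpoly_op /= !fct_sumE; apply: eq_bigr => i _.
by rewrite !fctE coefMX /= -iterS iterSr.
Qed.

Lemma cpoly_opX A : cpoly_op 'X A = A.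
Proof.
by rewrite -[X in cpoly_op X]mul1r cpoly_opMX cpoly_opC scale1r.
Qed.

Lemma cpoly_opM f g A : linear A ->
  cpoly_op (f * g) A = cpoly_op f A \o cpoly_op g A.
Proof.
move=> Al.
have gA x : cpoly_op g A (A x) = A (cpoly_op g A x).
  rewrite /cpoly_op !fct_sumE (big_morph A (linD Al) (lin0 Al)).
  by apply: eq_bigr => i _; rewrite !fctE (linZ Al) -iterS iterSr.
elim/poly_ind: f => [|f c IH].
  have op0 : cpoly_op 0 A = 0 by rewrite -[X in cpoly_op X](scale0r 0) cpoly_opZ scale0r.
  by rewrite mul0r op0.
rewrite mulrDl -mulrA (mulrC 'X) mulrA cpoly_opD cpoly_opMX IH.
rewrite mul_polyC cpoly_opZ cpoly_opD cpoly_opMX cpoly_opC.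
by apply/funext => x; rewrite !fctE /= gA.
Qed.

Lemma poly_opE p A : poly_op p A = cpoly_op (map_poly (real_complex R) p) A.
Proof.
rewrite /cpoly_op size_map_poly; apply: eq_bigr => i _.
by rewrite coef_map.
Qed.

Lemma poly_opD p q A : poly_op (p + q) A = poly_op p A + poly_op q A.
Proof. by rewrite !poly_opE rmorphD cpoly_opD. Qed.

Lemma poly_opZ (a : R) p A : poly_op (a *: p) A = a%:C *: poly_op p A.
Proof. by rewrite !poly_opE map_polyZ cpoly_opZ. Qed.

Lemma poly_opN p A : poly_op (- p) A = - poly_op p A.
Proof. by rewrite -scaleN1r poly_opZ rmorphN1 scaleN1r. Qed.

Lemma poly_opB p q A : poly_op (p - q) A = poly_op p A - poly_op q A.
Proof. by rewrite poly_opD poly_opN. Qed.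

Lemma poly_opC (a : R) A : poly_op a%:P A = a%:C *: idfun.
Proof. by rewrite !poly_opE map_polyC cpoly_opC. Qed.

Lemma poly_opX A : poly_op 'X A = A.
Proof. by rewrite !poly_opE map_polyX cpoly_opX. Qed.

Lemma poly_opM p q A : linear A -> poly_op (p * q) A = poly_op p A \o poly_op q A.
Proof. by move=> Al; rewrite !poly_opE rmorphM cpoly_opM. Qed.

End PolynomialCalculus.

(** * Spectra of self-adjoint operators and of their polynomials *)

Section Spectrum.
Context {R : realType} {H : completeNormedModType R[i]}.
Variable dot : {dot H for (@Num.conj R[i])}.
Hypothesis hdot : hilbert_dot dot.
Implicit Types (x y : H) (A B P Q : H -> H) (p q : {poly R}) (f g : {poly R[i]}).
Local Notation rd := (rdot dot).
Local Notation nm := (nrm dot).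
Local Notation rsa := (rsa dot).

Lemma bounded_cpoly f A : bounded_op A -> bounded_op (cpoly_op f A).
Proof.
move=> Ab; apply: (bounded_sum hdot) => i. apply: boundedZ.
elim: (nat_of_ord i) => [|j IH]; first exact: (bounded_id hdot).
exact: (bounded_comp hdot).
Qed.

Lemma bounded_poly p A : bounded_op A -> bounded_op (poly_op p A).
Proof. by rewrite poly_opE; exact: bounded_cpoly. Qed.

Lemma rsa_poly p A : rsa A -> rsa (poly_op p A).
Proof.
move=> As x y; rewrite /poly_op !fct_sumE [RHS]rdotC !rdot_suml; apply: eq_bigr => i _.
rewrite !fctE !rdotE; congr (_ * _).
elim: (nat_of_ord i) x y => [|j IH] x y; first exact: rdotC.
by rewrite iterS iterSr As rdotC -IH rdotC.
Qed.

Lemma rsa_shift (a : R) A : rsa A -> rsa (A - a%:C *: idfun).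
Proof. by move=> As x y; rewrite !fctE !rdotE As. Qed.

Lemma bounded_shift (a : R[i]) A : bounded_op A -> bounded_op (A - a *: idfun).
Proof. by move=> Ab; apply: (boundedB hdot) => //; apply: boundedZ; exact: bounded_id. Qed.

Lemma invertible_sides A V W : bounded_op V -> (forall x, A (V x) = x) ->
  (forall x, W (A x) = x) -> invertible_op A.
Proof.
move=> Vb AV WA; exists V; split=> //; apply/funext => x /=; first exact: AV.
by rewrite -[LHS]WA AV WA.
Qed.

Lemma invertible_comp A B : invertible_op A -> invertible_op B ->
  invertible_op (A \o B).
Proof.
move=> [A' [A'b AA' A'A]] [B' [B'b BB' B'B]]; exists (B' \o A'); split.
- exact: (bounded_comp hdot).
- by rewrite -compA (compA B) BB'.
- by rewrite -compA (compA A') A'A.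
Qed.

Lemma invertible_scalar (a : R[i]) : a != 0 -> invertible_op (a *: idfun : H -> H).
Proof.
move=> a0; exists (a^-1 *: idfun); split; first by apply: boundedZ; exact: bounded_id.
- by apply/funext => x; rewrite !fctE scalerA divff // scale1r.
- by apply/funext => x; rewrite !fctE scalerA mulVf // scale1r.
Qed.

(** Half of the spectral mapping theorem, in contrapositive form: [f] splits over [R[i]], so [f(A)]
    is a nonzero scalar times a product of invertible operators. *)
Lemma cpoly_invertible f A : bounded_op A -> f != 0 ->
  (forall z : R[i], root f z -> invertible_op (A - z *: idfun)) ->
  invertible_op (cpoly_op f A).
Proof.
move=> Ab f0; have [r fr] := closed_field_poly_normal f.
have l0 : lead_coef f != 0 by rewrite lead_coef_eq0.
rewrite fr => rinv; rewrite -mul_polyC (cpoly_opM _ _ Ab.1) cpoly_opC.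
apply: invertible_comp; first exact: invertible_scalar.
have {fr l0} : forall z, z \in r -> invertible_op (A - z *: idfun).
  by move=> z zr; apply: rinv; rewrite rootZ // root_prod_XsubC.
elim: r {rinv} => [_|z r IH rinv].
  by rewrite big_nil -[1]/(1%:P) cpoly_opC; exact/invertible_scalar/oner_neq0.
rewrite big_cons (cpoly_opM _ _ Ab.1); apply: invertible_comp.
  by rewrite -polyCN cpoly_opD cpoly_opX cpoly_opC scaleNr; apply: rinv; rewrite mem_head.
by apply: IH => w wr; apply: rinv; rewrite inE wr orbT.
Qed.

(** For [z = a + i b] with [b] nonzero, the product of [A - z] and [A - conj z] is
    [(A - a)^2 + b^2], which is coercive with constant [b^2]. The two factors commute, so inverting
    the product inverts [A - z] on both sides. *)
Lemma spectrum_real A (z : R[i]) : bounded_op A -> rsa A ->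
  spectrum A z -> complex.Im z = 0.
Proof.
move=> Ab As; apply: contra_notP => /eqP b0; have Al := Ab.1.
case: z b0 => a b /= b0; set z := a +i* b.
pose p := ('X - a%:P) * ('X - a%:P) + (b ^+ 2)%:P.
pose P := poly_op p A.
have PE x : P x = poly_op ('X - a%:P) A (poly_op ('X - a%:P) A x) + (b ^+ 2)%:C *: x.
  by rewrite /P /p poly_opD (poly_opM _ _ Al) poly_opC !fctE.
have : invertible_op P.
  apply: (coercive_invertible hdot (c := b ^+ 2)).
  - exact: bounded_poly.
  - exact: rsa_poly.
  - by rewrite exprn_even_gt0.
  move=> x; rewrite PE !rdotE (rsa_poly ('X - a%:P) As).
  by rewrite lerDr rdot_ge0.
move=> [Pi [Pib PPi PiP]].
have pE : map_poly (real_complex R) p = ('X - z%:P) * ('X - (a -i* b)%:P).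
  rewrite /p rmorphD rmorphM rmorphB /= map_polyX !map_polyC /=.
  have -> : z = a%:C + 'i * b%:C by exact: (complexE z).
  have -> : a -i* b = a%:C - 'i * b%:C.
    by rewrite [LHS]complexE /= rmorphN mulrN.
  rewrite polyCB polyCD polyCM rmorphXn polyCM /=.
  have : ('i%C%:P * 'i%C%:P : {poly R[i]}) = -1.
    by rewrite -polyCM -expr2 sqr_i polyCN.
  move: ('i%C%:P : {poly R[i]}) (a%:C%:P : {poly R[i]}) (b%:C%:P : {poly R[i]}).
  move=> j u v jj; have -> : ('X - (u + j * v)) * ('X - (u - j * v)) =
     ('X - u) * ('X - u) - (j * j) * v * v by ring.
  by rewrite jj; ring.
have zE w : cpoly_op ('X - w%:P) A = A - w *: idfun.
  by rewrite -polyCN cpoly_opD cpoly_opX cpoly_opC scaleNr.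
have PE1 : P = (A - z *: idfun) \o (A - (a -i* b) *: idfun).
  by rewrite /P poly_opE pE (cpoly_opM _ _ Al) !zE.
have PE2 : P = (A - (a -i* b) *: idfun) \o (A - z *: idfun).
  by rewrite /P poly_opE pE mulrC (cpoly_opM _ _ Al) !zE.
apply: (@invertible_sides _ ((A - (a -i* b) *: idfun) \o Pi)
                            (Pi \o (A - (a -i* b) *: idfun))).
- by apply: (bounded_comp hdot) => //; exact: bounded_shift.
- move=> x; have := congr1 (fun h => h x) PPi; rewrite PE1.
  by move=> h; rewrite -[RHS]h.
- move=> x; have := congr1 (fun h => h x) PiP; rewrite PE2.
  by move=> h; rewrite -[RHS]h.
Qed.

(** At the greatest lower bound [m] of the form, [Q - m] is positive. Were it invertible it would be
    coercive with some [c > 0], and [m + c] would be a larger lower bound. *)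
Lemma form_inf_spectrum Q : bounded_op Q -> rsa Q -> (exists x : H, x != 0) ->
  exists2 m : R, (forall x, m * rd x x <= rd (Q x) x) & spectrum Q m%:C.
Proof.
move=> Qb Qs [x0 x00].
have [M M0 QM] := bounded_form hdot Qb.
have rp x : x != 0 -> 0 < rd x x.
  by move=> xN; rewrite lt_def rdot_ge0 andbT; apply: contra_neq xN => /rdot_eq0.
pose E := [set r : R | forall x, r * rd x x <= rd (Q x) x]%classic.
have Eub x : x != 0 -> ubound E (rd (Q x) x / rd x x).
  by move=> xN r /(_ x) h; rewrite ler_pdivlMr ?rp.
have EN : E (- M).
  by move=> x; have := QM x; rewrite ler_norml => /andP[]; rewrite mulNr.
have Es : has_sup E by split; [exists (- M)|exists (rd (Q x0) x0 / rd x0 x0); exact: Eub].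
have Em : E (sup E).
  move=> x; have [->|xN] := eqVneq x 0; first by rewrite !rdot0r mulr0.
  by rewrite -ler_pdivlMr ?rp //; apply: ge_sup; [exists (- M)|exact: Eub].
exists (sup E) => //.
move=> /(invertible_coercive hdot) -[||y|c c0 cE].
- exact: bounded_shift.
- exact: rsa_shift.
- by rewrite !fctE !rdotE subr_ge0; exact: Em.
have : E (sup E + c).
  by move=> x; have := cE x; rewrite !fctE !rdotE /=; lra.
by move=> /(ub_le_sup Es.2); rewrite gerDl leNgt c0.
Qed.

Lemma poly_op_ge0 p A : bounded_op A -> rsa A ->
  (forall t : R, spectrum A t%:C -> 0 <= p.[t]) ->
  forall x, 0 <= rd (poly_op p A x) x.
Proof.
move=> Ab As p0 x; have [->|xN] := eqVneq x 0; first by rewrite rdot0r.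
have Hn : exists x : H, x != 0 by exists x.
have [m mQ mS] := form_inf_spectrum (bounded_poly p Ab) (rsa_poly p As) Hn.
suff [t St pt] : exists2 t : R, spectrum A t%:C & p.[t] = m.
  by apply: le_trans (mQ x); rewrite mulr_ge0 ?rdot_ge0 // -pt p0.
(* A constant [p] leaves no nonzero polynomial to factor; the required point then comes from the
   spectrum of [A], nonempty because [H] contains the nonzero [x]. *)
have [/eqP|pm] := eqVneq (p - m%:P) 0.
  rewrite subr_eq0 => /eqP ->; have [t _ St] := form_inf_spectrum Ab As Hn.
  by exists t => //; rewrite hornerC.
have : ~ invertible_op (cpoly_op (map_poly (real_complex R) (p - m%:P)) A).
  by rewrite -poly_opE poly_opB poly_opC.
apply: contra_notP => nt; apply: cpoly_invertible => //.
  by rewrite map_poly_eq0.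
move=> z rz; apply: contrapT => Sz; apply: nt.
have := spectrum_real Ab As Sz; case: z rz Sz => t b /= rz Sz b0.
move: rz Sz; rewrite b0 => rz Sz.
exists t => //; move: rz; rewrite complexr0 /root horner_map /=.
by rewrite eq_complex /= eqxx andbT !hornerE subr_eq0 => /eqP.
Qed.

Lemma poly_op_le p q A : bounded_op A -> rsa A ->
  (forall t : R, spectrum A t%:C -> p.[t] <= q.[t]) ->
  forall x, rd (poly_op p A x) x <= rd (poly_op q A x) x.
Proof.
move=> Ab As pq x; rewrite -subr_ge0.
have := @poly_op_ge0 (q - p) A Ab As _ x; rewrite poly_opB !fctE !rdotE; apply.
by move=> t /pq; rewrite !hornerE subr_ge0.
Qed.

Lemma opnorm_poly_op p A (e : R) : bounded_op A -> rsa A -> 0 < e ->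
  (forall t : R, spectrum A t%:C -> `|p.[t]| <= e) -> opnorm_le (poly_op p A) e.
Proof.
move=> Ab As e0 pe; apply: (opnorm_le_form hdot) => //.
- exact: (bounded_poly p Ab).1.
- exact: rsa_poly.
move=> x; rewrite ler_norml; apply/andP; split.
  have := @poly_op_le (- e)%:P p A Ab As _ x.
  rewrite poly_opC !fctE rdotE mulNr; apply => t /pe.
  by rewrite hornerC ler_norml => /andP[].
have := @poly_op_le p e%:P A Ab As _ x.
rewrite poly_opC !fctE rdotE; apply => t /pe.
by rewrite hornerC ler_norml => /andP[].
Qed.

Lemma spectrum_form_bounds A (c M : R) : bounded_op A -> rsa A ->
  (forall x, c * rd x x <= rd (A x) x) -> (forall x, rd (A x) x <= M * rd x x) ->
  forall t : R, spectrum A t%:C -> c <= t <= M.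
Proof.
move=> Ab As cA AM t St; apply/andP; split; rewrite leNgt; apply/negP => tc; apply: St.
  apply: (coercive_invertible hdot (c := c - t)); rewrite ?subr_gt0 //.
  - exact: bounded_shift.
  - exact: rsa_shift.
  - by move=> x; rewrite !fctE !rdotE; have := cA x; rewrite /=; lra.
have -> : A - t%:C *: idfun = ((-1)%:C *: idfun) \o (t%:C *: idfun - A).
  by apply/funext => x; rewrite !fctE rmorphN1 scaleN1r opprB.
apply: invertible_comp.
  by apply: invertible_scalar; rewrite eq_complex /= oppr_eq0 oner_eq0.
apply: (coercive_invertible hdot (c := t - M)); rewrite ?subr_gt0 //.
- by apply: (boundedB hdot) => //; apply: boundedZ; exact: bounded_id.
- by move=> x y; rewrite !fctE !rdotE As.
- by move=> x; rewrite !fctE !rdotE; have := AM x; rewrite /=; lra.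
Qed.

End Spectrum.

(** * Scalar inequalities and approximation *)

Section ScalarInequalities.
Context {R : realType}.
Implicit Types (a b c p q r s t x : R).

Lemma powR_expR t r : 0 < t -> t `^ r = expR (r * ln t).
Proof. by move=> t0; rewrite /powR gt_eqF. Qed.

Lemma ln_leB1 t : 0 < t -> ln t <= t - 1.
Proof. by move=> t0; have := @le_ln1Dx R (t - 1); rewrite addrCA subrr addr0; apply; lra. Qed.

Lemma ln_ge_1BV t : 0 < t -> 1 - t^-1 <= ln t.
Proof.
move=> t0; have := @ln_leB1 t^-1; rewrite invr_gt0 lnV ?posrE // => /(_ t0); lra.
Qed.

Lemma powR_le_affine p t : 0 <= p <= 1 -> 0 < t -> t `^ p <= (1 - p) + p * t.
Proof.
move=> /andP[p0 p1] t0; set u := _ + _.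
have u0 : 0 < u.
  have [pe|pN] := eqVneq p 1; first by rewrite /u pe subrr add0r mul1r.
  by rewrite ltr_wpDr ?mulr_ge0 ?(ltW t0) // subr_gt0 lt_neqAle pN.
rewrite powR_expR // -ler_ln ?posrE ?expR_gt0 // expRK.
have h1 : ln t - ln u <= t / u - 1.
  by rewrite -ln_div ?posrE //; apply: ln_leB1; rewrite divr_gt0.
have h2 : - ln u <= u^-1 - 1.
  by rewrite -lnV ?posrE //; apply: ln_leB1; rewrite invr_gt0.
have : p * (t / u - 1) + (1 - p) * (u^-1 - 1) = 0.
  by rewrite /u; field; rewrite -/u gt_eqF.
have : p * (ln t - ln u) <= p * (t / u - 1) by rewrite ler_wpM2l.
have : (1 - p) * (- ln u) <= (1 - p) * (u^-1 - 1) by rewrite ler_wpM2l ?subr_ge0.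
lra.
Qed.

Lemma powR_ge_inv p t : 0 <= p -> 0 < t -> 1 + p * (1 - t^-1) <= t `^ p.
Proof.
move=> p0 t0; rewrite powR_expR //; apply: le_trans (expR_ge1Dx _).
by rewrite lerD2l ler_wpM2l // ln_ge_1BV.
Qed.

(** Bernoulli's inequality, obtained from the concave case with exponent [1 / q] at the point
    [t^q]. *)
Lemma powR_ge_affine q t : 1 <= q -> 0 < t -> 1 + q * (t - 1) <= t `^ q.
Proof.
move=> q1 t0; have q0 : 0 < q by apply: lt_le_trans q1.
have := @powR_le_affine q^-1 (t `^ q); rewrite invr_ge0 (ltW q0) invf_le1 // q1 powR_gt0 //.
move=> /(_ isT isT); rewrite -powRrM divff ?gt_eqF // powRr1 ?(ltW t0) // => h.
have : q * t <= q * (1 - q^-1 + q^-1 * t `^ q) by rewrite ler_pM2l.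
have -> : q * (1 - q^-1 + q^-1 * t `^ q) = q - 1 + t `^ q by field; rewrite gt_eqF.
lra.
Qed.

Lemma mean_gt0 (k : nat) (lam mu : 'I_k -> R) :
  prob_vec lam -> (forall i, 0 < mu i) -> 0 < \sum_i lam i * mu i.
Proof.
move=> [l0 l1] mu0; rewrite lt_def sumr_ge0 ?andbT => [|i _]; last by rewrite mulr_ge0 ?ltW.
apply/eqP => m0; have : \sum_i lam i = 0.
  apply: big1 => i _.
  have /(_ i isT)/eqP := psumr_eq0P (fun j _ => mulr_ge0 (ltW (l0 j)) (ltW (mu0 j))) m0.
  by rewrite mulf_eq0 (gt_eqF (mu0 i)) orbF => /eqP.
by rewrite l1 => /eqP; rewrite oner_eq0.
Qed.

(** Jensen's inequality by the tangent of [t^q] at the arithmetic mean [m]: the linear terms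
    [mu i / m - 1] average to 0. *)
Lemma mean_le_power_mean q (k : nat) (lam mu : 'I_k -> R) : 1 <= q ->
  prob_vec lam -> (forall i, 0 < mu i) ->
  \sum_i lam i * mu i <= real_power_mean q lam mu.
Proof.
move=> q1 hlam mu0; have q0 : 0 < q by apply: lt_le_trans q1.
have m0 := mean_gt0 hlam mu0; have [l0 l1] := hlam.
set m := \sum_i lam i * mu i in m0 *.
rewrite /real_power_mean div1r; set s := \sum_i _.
suff ms : m `^ q <= s.
  have -> : m = (m `^ q) `^ q^-1.
    by rewrite -powRrM divff ?gt_eqF // powRr1 // ltW.
  apply: ge0_ler_powR; rewrite ?nnegrE ?powR_ge0 //; first by rewrite invr_ge0 ltW.
  exact: le_trans (powR_ge0 _ _) ms.
have -> : m `^ q = \sum_i lam i * (m `^ q * (1 + q * (mu i / m - 1))).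
  transitivity (m `^ q * (\sum_i lam i + q * (m^-1 * m - \sum_i lam i))).
    by rewrite l1 mulVf ?gt_eqF // subrr mulr0 addr0 mulr1.
  rewrite {3}/m !mulr_sumr -sumrB mulr_sumr -big_split mulr_sumr /=.
  by apply: eq_bigr => i _; ring.
apply: ler_sum => i _; rewrite ler_pM2l //.
have -> : mu i `^ q = m `^ q * (mu i / m) `^ q.
  by rewrite -powRM ?ltW ?divr_gt0 // mulrC divfK ?gt_eqF.
by rewrite ler_pM2l ?powR_gt0 // powR_ge_affine ?divr_gt0.
Qed.

Lemma ln_lipschitz c s t : 0 < c -> c <= s -> c <= t ->
  `|ln s - ln t| <= c^-1 * `|s - t|.
Proof.
move=> c0; wlog st : s t / t <= s => [h cs ct|cs ct].
  have [|/ltW] := leP t s => ts; first exact: h.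
  by rewrite distrC (distrC s); exact: h.
have t0 : 0 < t by lra.
have s0 : 0 < s by lra.
rewrite !ger0_norm ?subr_ge0 ?ler_ln ?posrE // -ln_div ?posrE //.
apply: (le_trans (ln_leB1 (divr_gt0 s0 t0))).
have -> : s / t - 1 = t^-1 * (s - t) by field; rewrite gt_eqF.
by rewrite ler_wpM2r ?subr_ge0 // lef_pV2 ?posrE.
Qed.

Lemma powR_bounded c d r : 0 < c ->
  exists2 E : R, 0 < E & forall t, c <= t <= d -> `|t `^ r| <= E.
Proof.
move=> c0; exists (expR (`|r| * (`|ln c| + `|ln d|))); first exact: expR_gt0.
move=> t /andP[ct td]; have t0 : 0 < t by lra.
have d0 : 0 < d by lra.
rewrite ger0_norm ?powR_ge0 // powR_expR // ler_expR.
apply: (le_trans (ler_norm _)); rewrite normrM ler_wpM2l //.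
have h1 : ln c <= ln t by rewrite ler_ln.
have h2 : ln t <= ln d by rewrite ler_ln.
have := ler_norm (ln d); have := ler_norm (- ln c); rewrite normrN.
have := normr_ge0 (ln c); have := normr_ge0 (ln d).
by rewrite ler_norml => *; apply/andP; split; lra.
Qed.

Lemma powR_lipschitz c d r : 0 < c -> exists2 L : R, 0 <= L &
  forall s t, c <= s <= d -> c <= t <= d -> `|s `^ r - t `^ r| <= L * `|s - t|.
Proof.
move=> c0; have [E E0 rE] := powR_bounded d r c0.
exists (E * `|r| * c^-1); first by rewrite !mulr_ge0 ?invr_ge0 ?(ltW c0) ?(ltW E0).
suff h s t : c <= s <= d -> c <= t <= d ->
    s `^ r - t `^ r <= E * `|r| * c^-1 * `|s - t|.
  move=> s t hs ht; rewrite ler_norml lerNl opprB h // andbT.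
  by rewrite (distrC s) h.
move=> hs ht; have s0 : 0 < s by case/andP: hs; lra.
have t0 : 0 < t by case/andP: ht; lra.
(* The tangent of the exponential at [r * ln s] lies below it at [r * ln t]; this reduces the
   estimate to the Lipschitz bound for [ln]. *)
have : s `^ r - t `^ r <= s `^ r * (r * ln s - r * ln t).
  rewrite !powR_expR //; set a := r * ln s; set b := r * ln t.
  have : expR a * (1 + (b - a)) <= expR b.
    have -> : expR b = expR a * expR (b - a) by rewrite -expRD addrC subrK.
    by rewrite ler_pM2l ?expR_gt0 // expR_ge1Dx.
  lra.
move=> /le_trans; apply; apply: (le_trans (ler_norm _)).
rewrite -mulrBr !normrM -!mulrA; apply: ler_pM => //.
- exact: rE.
- by rewrite ler_wpM2l // ln_lipschitz //; [case/andP: hs|case/andP: ht].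
Qed.

End ScalarInequalities.

(** * Bernstein approximation of Lipschitz functions *)

Section Bernstein.
Context {R : realType}.
Implicit Types (g h : nat -> R) (f : R -> R).

(* Bernstein polynomial [\sum_k 'C(n, k) g(k) X^k (1 - X)^(n - k)], by
   conditioning on the first Bernoulli trial. *)
Fixpoint bernstein (n : nat) g : {poly R} :=
  if n is n'.+1 then
    'X * bernstein n' (fun k => g k.+1) + (1 - 'X) * bernstein n' g
  else (g 0%N)%:P.

Let bernsteinS n g (x : R) : (bernstein n.+1 g).[x] =
  x * (bernstein n (fun k => g k.+1)).[x] + (1 - x) * (bernstein n g).[x].
Proof. by rewrite /= !hornerE. Qed.

Lemma bernstein_lin n (a : R) g h (x : R) :
  (bernstein n (fun k => a * g k + h k)).[x] =
  a * (bernstein n g).[x] + (bernstein n h).[x].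
Proof.
elim: n g h => [|n IH] g h; first by rewrite /= !hornerC.
by rewrite !bernsteinS !IH; ring.
Qed.

Lemma bernstein_const n (a x : R) : (bernstein n (fun=> a)).[x] = a.
Proof.
elim: n => [|n IH]; first by rewrite /= hornerC.
by rewrite !bernsteinS !IH; ring.
Qed.

(** Second moment of a binomial variable. The centre [a] stays free because conditioning on a
    successful first trial moves it to [a - 1]; at [a = n x] only the variance remains. *)
Lemma bernstein_var n (a x : R) :
  (bernstein n (fun k => (k%:R - a) ^+ 2)).[x] =
  (n%:R * x - a) ^+ 2 + n%:R * (x * (1 - x)).
Proof.
elim: n a => [|n IH] a; first by rewrite /= hornerC !mul0r addr0.
rewrite bernsteinS IH.
have -> : (fun k => (k.+1%:R - a) ^+ 2) = (fun k => (k%:R - (a - 1)) ^+ 2).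
  by apply/funext => k; rewrite -natr1 opprB addrA addrAC.
by rewrite IH -natr1; ring.
Qed.

Lemma bernstein_le n g h (x : R) : 0 <= x <= 1 ->
  (forall k, (k <= n)%N -> g k <= h k) -> (bernstein n g).[x] <= (bernstein n h).[x].
Proof.
move=> /andP[x0 x1]; elim: n g h => [|n IH] g h gh; first by rewrite /= !hornerC gh.
rewrite !bernsteinS lerD // ler_wpM2l ?subr_ge0 //; apply: IH => k kn; apply: gh => //.
exact: ltnW.
Qed.

(** The bound [|y| <= y^2 / d + d] replaces the distance to [t] by a quadratic, whose Bernstein
    average is known exactly from the variance. The choice of [d] makes [L d] at most [e / 2], and
    then [n] makes the variance term at most [e / 2]. *)
Lemma bernstein_approx f (L e : R) : 0 <= L -> 0 < e ->
  (forall s t : R, 0 <= s <= 1 -> 0 <= t <= 1 -> `|f s - f t| <= L * `|s - t|) ->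
  exists p : {poly R}, forall t : R, 0 <= t <= 1 -> `|p.[t] - f t| <= e.
Proof.
(* Dividing by [L + 1] rather than [L] covers [L = 0]. *)
move=> L0 e0 fL; pose d := e / (2 * (L + 1)).
have L1 : 0 < 2 * (L + 1) by lra.
have d0 : 0 < d by exact: divr_gt0.
have Ld : L * d <= e / 2.
  have -> : e / 2 = (L + 1) * d by rewrite /d; field; lra.
  by rewrite ler_wpM2r ?(ltW d0) // lerDl.
clearbody d.
pose n := (Num.truncn (2 * L / (d * e))).+1.
have n0 : 0 < n%:R :> R by rewrite ltr0n.
have nL : L / (d * n%:R) <= e / 2.
  have : 2 * L / (d * e) < n%:R by rewrite truncnS_gt.
  rewrite ltr_pdivrMr ?mulr_gt0 // => h.
  rewrite ler_pdivrMr ?mulr_gt0 //; lra.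
pose g k := f (k%:R / n%:R).
exists (bernstein n g) => t t01.
have key k : (k <= n)%N -> `|g k - f t| <=
    L / d / n%:R ^+ 2 * (k%:R - n%:R * t) ^+ 2 + L * d.
  move=> kn; have k01 : (0 : R) <= k%:R / n%:R <= (1 : R).
    by apply/andP; split; [rewrite divr_ge0|rewrite ler_pdivrMr // mul1r ler_nat].
  apply: (le_trans (fL _ _ k01 t01)); set y := _ - t.
  have -> : k%:R - n%:R * t = n%:R * y by rewrite /y; field; rewrite gt_eqF.
  have -> : L / d / n%:R ^+ 2 * (n%:R * y) ^+ 2 + L * d = L * (y ^+ 2 / d + d).
    by field; rewrite !gt_eqF.
  rewrite ler_wpM2l // -(ler_pM2r d0) mulrDl divfK ?gt_eqF // -real_normK ?num_real //.
  by have := normr_ge0 y; nra.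
have bt : (bernstein n (fun k => L / d / n%:R ^+ 2 * (k%:R - n%:R * t) ^+ 2 + L * d)).[t] <= e.
  rewrite (bernstein_lin n _ (fun k => (k%:R - n%:R * t) ^+ 2) (fun=> L * d)).
  rewrite bernstein_const bernstein_var subrr expr0n add0r /=.
  have tt : t * (1 - t) <= 1 by case/andP: t01 => *; nra.
  have : L / d / n%:R ^+ 2 * (n%:R * (t * (1 - t))) <= L / (d * n%:R).
    have -> : L / d / n%:R ^+ 2 * (n%:R * (t * (1 - t))) = L / (d * n%:R) * (t * (1 - t)).
      by field; rewrite !gt_eqF.
    by rewrite ler_piMr // divr_ge0 // mulr_ge0 // ltW.
  lra.
have E : (bernstein n g).[t] - f t = (bernstein n (fun k => 1 * g k + - f t)).[t].
  by rewrite (bernstein_lin n 1 g (fun=> - f t)) bernstein_const mul1r.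
rewrite E ler_norml; apply/andP; split; last first.
  apply: le_trans bt; apply: bernstein_le => // k /key; rewrite mul1r ler_norml.
  by case/andP.
rewrite lerNl.
have -> : - (bernstein n (fun k => 1 * g k + - f t)).[t] = (bernstein n (fun k => -1 * g k + f t)).[t].
  rewrite (bernstein_lin n 1 g (fun=> - f t)) (bernstein_lin n (-1) g (fun=> f t)).
  by rewrite !bernstein_const; ring.
apply: le_trans bt; apply: bernstein_le => // k /key; rewrite ler_norml mulN1r.
by case/andP => h _; lra.
Qed.

Lemma lipschitz_approx f (c d L : R) : c < d -> 0 <= L ->
  (forall s t : R, c <= s <= d -> c <= t <= d -> `|f s - f t| <= L * `|s - t|) ->
  forall e : R, 0 < e ->
  exists p : {poly R}, forall t : R, c <= t <= d -> `|p.[t] - f t| <= e.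
Proof.
move=> cd L0 fL e e0; have dc0 : 0 < d - c by rewrite subr_gt0.
pose phi u := c + (d - c) * u.
have phiI u : 0 <= u <= 1 -> c <= phi u <= d.
  by move=> /andP[u0 u1]; rewrite /phi; apply/andP; split; nra.
have [|||p pf] := @bernstein_approx (f \o phi) (L * (d - c)) e.
- by rewrite mulr_ge0 // ltW.
- exact: e0.
- move=> s t s01 t01; apply: (le_trans (fL _ _ (phiI _ s01) (phiI _ t01))).
  have -> : phi s - phi t = (d - c) * (s - t) by rewrite /phi; ring.
  by rewrite normrM (ger0_norm (ltW dc0)) mulrA.
exists (p \Po ((d - c)^-1 *: ('X - c%:P))) => t /andP[ct td].
have := pf ((d - c)^-1 * (t - c)).
rewrite /= /phi mulrA divff ?gt_eqF // mul1r (addrC c) subrK horner_comp !hornerE; apply.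
by rewrite mulrC divr_ge0 ?subr_ge0 ?(ltW cd) //= ler_pdivrMr // mul1r lerD2r.
Qed.

End Bernstein.

(** * Continuous functional calculus *)

Section FunctionalCalculus.
Context {R : realType} {H : completeNormedModType R[i]}.
Variable dot : {dot H for (@Num.conj R[i])}.
Hypothesis hdot : hilbert_dot dot.
Implicit Types (x y : H) (A B P Q : H -> H) (p q h s : {poly R}) (f g : R -> R).
Local Notation rd := (rdot dot).
Local Notation nm := (nrm dot).
Local Notation rsa := (rsa dot).

(** Passage to the limit: facts about [f(A)] are shown for an approximating polynomial with an error
    proportional to [e], then [e] is removed here. *)
Let small (a K : R) : (forall e : R, 0 < e -> a <= e * K) -> a <= 0.
Proof.
move=> aK; rewrite leNgt; apply/negP => a0.
have K0 : 0 < K.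
  by rewrite ltNge; apply/negP => K0; have := aK 1 ltr01; rewrite mul1r; lra.
have := aK (a / K / 2); rewrite !divr_gt0 // => /(_ isT).
rewrite mulrAC divfK ?gt_eqF //; lra.
Qed.

Lemma is_fun_calcP f A B : is_fun_calc f A B <->
  bounded_op B /\ forall e : R, 0 < e -> exists p,
    (forall t : R, spectrum A t%:C -> `|p.[t] - f t| <= e) /\
    forall x, nm (poly_op p A x - B x) <= e * nm x.
Proof.
split=> -[Bb fAB]; split=> // e /fAB[p [pf pB]]; exists p; split=> //.
  by move=> x; have /(opnorm_leP hdot)/(_ x) := pB.
exact/(opnorm_leP hdot).
Qed.

Section SelfAdjoint.
Variable A : H -> H.
Hypotheses (Ab : bounded_op A) (As : rsa A).

(** Approximants [p n] with tolerance [1 / (n + 1)] differ on the spectrum by at most the sum of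
    their tolerances, so [opnorm_poly_op] makes [p n (A)] Cauchy in operator norm. The pointwise
    limit is then a norm limit, and one witness is enough for [xget]. *)
Lemma fun_calc_exists f :
  (forall e : R, 0 < e -> exists p,
    forall t : R, spectrum A t%:C -> `|p.[t] - f t| <= e) ->
  is_fun_calc f A (fun_calc f A).
Proof.
move=> approx; apply: xgetPex => /=.
have en (n : nat) : 0 < n.+1%:R^-1 :> R by rewrite invr_gt0.
have /choice[p pf] n := approx _ (en n).
have pB n m x : nm (poly_op (p n) A x - poly_op (p m) A x) <=
    (n.+1%:R^-1 + m.+1%:R^-1) * nm x.
  have -> : poly_op (p n) A x - poly_op (p m) A x = poly_op (p n - p m) A x.
    by rewrite poly_opB.
  move: x; apply/(opnorm_leP hdot); apply: (opnorm_poly_op hdot) => // t St.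
  rewrite hornerD hornerN; have := pf n t St; have := pf m t St.
  move: (n.+1%:R^-1) (m.+1%:R^-1) => a b.
  by rewrite !ler_norml => /andP[? ?] /andP[? ?]; apply/andP; split; lra.
have archi (e : R) : 0 < e -> exists N : nat, forall n : nat, (N <= n)%N ->
    n.+1%:R^-1 <= e.
  move=> e0; exists (Num.truncn e^-1) => n Nn; rewrite -[e]invrK.
  rewrite lef_pV2 ?posrE ?invr_gt0 // ltW // (lt_le_trans (truncnS_gt _)) //.
  by rewrite ler_nat ltnS.
have ex x : exists l, forall e : R, 0 < e -> exists N : nat, forall n : nat,
    (N <= n)%N -> nm (poly_op (p n) A x - l) <= e.
  apply: (nrm_complete hdot) => e e0.
  have K0 : 0 < 2 * nm x + 1 by have := nrm_ge0 dot x; lra.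
  have [N eN] := archi (e / (2 * nm x + 1)) (divr_gt0 e0 K0).
  exists N => n m /eN h1 /eN h2; apply: (le_trans (pB _ _ _)).
  have -> : e = e / (2 * nm x + 1) * (2 * nm x + 1) by rewrite divfK ?gt_eqF.
  set d := e / _; have d0 : 0 < d by exact: divr_gt0.
  have := nrm_ge0 dot x; set k := nm x => k0.
  have : (n.+1%:R^-1 + m.+1%:R^-1) * k <= (d + d) * k by rewrite ler_wpM2r ?lerD.
  by move=> h; apply: (le_trans h); lra.
have {ex} /choice[B BP] := ex.
(* Comparing with the index [maxn N n], where [N] depends on [x] but the bound does not, makes the
   convergence uniform in [x]. *)
have Bn n x : nm (poly_op (p n) A x - B x) <= 2 * n.+1%:R^-1 * nm x.
  apply/ler_addgt0Pl => e e0.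
  have [N hN] := BP x e e0.
  have hm := hN (maxn N n) (leq_maxl _ _).
  have -> : poly_op (p n) A x - B x = (poly_op (p (maxn N n)) A x - B x) +
      (poly_op (p n) A x - poly_op (p (maxn N n)) A x) by rewrite [RHS]addrC addrA subrK.
  apply: (le_trans (nrmD hdot _ _)); apply: lerD => //.
  apply: (le_trans (pB _ _ _)); rewrite ler_wpM2r ?nrm_ge0 //.
  have : (maxn N n).+1%:R^-1 <= n.+1%:R^-1 :> R.
    by rewrite lef_pV2 ?posrE // ler_nat ltnS leq_maxr.
  by move: (n.+1%:R^-1) (_.+1%:R^-1) => a b; lra.
have Be (e : R) : 0 < e -> exists q,
    (forall t : R, spectrum A t%:C -> `|q.[t] - f t| <= e) /\
    forall x, nm (poly_op q A x - B x) <= e * nm x.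
  move=> e0; have [N hN] := archi (e / 2) (divr_gt0 e0 (ltr0Sn _ _)).
  have {hN} := hN N (leqnn N) => hN.
  exists (p N); split=> [t St|x].
    by apply: (le_trans (pf N t St)); apply: (le_trans hN); lra.
  by apply: (le_trans (Bn N x)); rewrite ler_wpM2r ?nrm_ge0 // mulrC -ler_pdivlMr.
exists B; apply/is_fun_calcP; split=> //.
have [q [_ qB]] := Be 1 ltr01.
have /(bounded_opP hdot)[ql [c c0 qc]] := bounded_poly hdot q Ab.
apply/(bounded_opP hdot); split=> [k x y|].
  apply/eqP; rewrite -subr_eq0; apply/eqP; apply: (@nrm_le0 _ _ dot).
  pose Z := nm (k *: x + y) + complex.Re `|k| * nm x + nm y.
  apply: (@small _ Z) => e /Be[r [_ rB]].
  have rl := (bounded_poly hdot r Ab).1.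
  have -> : B (k *: x + y) - (k *: B x + B y) =
    - (poly_op r A (k *: x + y) - B (k *: x + y)) +
    (k *: (poly_op r A x - B x) + (poly_op r A y - B y)).
    rewrite rl scalerBr opprB (addrACA (k *: poly_op r A x)).
    by rewrite [RHS]addrA subrK opprD.
  have nk : nm (k *: (poly_op r A x - B x)) = complex.Re `|k| * nm (poly_op r A x - B x).
    have e' : `|k| = (complex.Re `|k|)%:C by rewrite RRe_real ?normr_real.
    by apply: (@complexI R); rewrite rmorphM /= -e' -!(normE hdot) normrZ.
  have k0 : 0 <= complex.Re `|k| by have := normr_ge0 k; rewrite lecE => /andP[].
  rewrite /Z 2!mulrDr -addrA; apply: (le_trans (nrmD hdot _ _)); apply: lerD.
    by rewrite nrmN.
  apply: (le_trans (nrmD hdot _ _)); apply: lerD => //.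
  by rewrite nk mulrCA ler_wpM2l.
exists (c + 1); first by rewrite addr_gt0.
move=> x; rewrite -(subrK (poly_op q A x) (B x)); apply: (le_trans (nrmD hdot _ _)).
rewrite addrC mulrDl lerD //.
by rewrite nrmB.
Qed.

Variables (f : R -> R) (B : H -> H).
Hypothesis fB : is_fun_calc f A B.

Let Bb : bounded_op B := fB.1.

Lemma fun_calc_rsa : rsa B.
Proof.
move=> x y; apply/eqP; rewrite -subr_eq0 -normr_eq0; apply/eqP/le_anti.
rewrite normr_ge0 andbT; apply: (@small _ (2 * (nm x * nm y))) => e.
have [_ app] := (is_fun_calcP _ _ _).1 fB; move=> /app[p [_ pB]].
have := rsa_poly p As x y.
have h u v : `|rd (poly_op p A u - B u) v| <= e * (nm u * nm v).
  have l : nm (poly_op p A u - B u) * nm v <= e * (nm u * nm v).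
    by rewrite mulrA ler_wpM2r ?nrm_ge0.
  rewrite ler_norml lerNl -rdotNl; apply/andP; split; apply: le_trans l.
    by rewrite -(nrmN dot) rdot_le_nrm.
  exact: rdot_le_nrm.
have := h x y; have := h y x; rewrite (mulrC (nm y)) !(rdotC _ (_ - _)) !rdotE.
rewrite !(rdotC _ x) !(rdotC _ y) !ler_norml.
by move=> /andP[? ?] /andP[? ?] ?; apply/andP; split; lra.
Qed.

(** The factor [s^2] clears denominators: a lower bound for [f] that involves [1 / t] becomes a
    polynomial bound, at the price of testing [f(A)] at [s(A) x]. The proof compares [h] with
    [s (p + e) s] for an approximant [p]; the shift by [e] and the norm error make up the factor
    2. *)
Lemma fun_calc_ge s h :
  (forall t : R, spectrum A t%:C -> h.[t] <= s.[t] ^+ 2 * f t) ->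
  forall x, rd (poly_op h A x) x <= rd (B (poly_op s A x)) (poly_op s A x).
Proof.
move=> hf x; rewrite -subr_le0; set y := poly_op s A x.
apply: (@small _ (2 * rd y y)) => e e0.
have [_ /(_ e e0)[p [pf pB]]] := (is_fun_calcP _ _ _).1 fB.
have := @poly_op_le _ _ _ hdot h (s * (p + e%:P) * s) A Ab As _ x.
rewrite !(poly_opM _ _ Ab.1) poly_opD poly_opC /= (rsa_poly s As) -/y !fctE !rdotE.
move=> hp; have {}hp : rd (poly_op h A x) x <= rd (poly_op p A y) y + e * rd y y.
  apply: hp => t St; apply: (le_trans (hf t St)).
  have -> : (s * (p + e%:P) * s).[t] = s.[t] ^+ 2 * (p.[t] + e).
    by rewrite !hornerM hornerD hornerC; ring.
  rewrite ler_wpM2l ?sqr_ge0 //; have := pf t St; rewrite ler_norml => /andP[? _]; lra.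
have := rdot_le_nrm dot (poly_op p A y - B y) y; rewrite !rdotE.
have : nm (poly_op p A y - B y) * nm y <= e * rd y y.
  by rewrite -nrm_sqr expr2 mulrA ler_wpM2r ?nrm_ge0.
lra.
Qed.

Lemma fun_calc_le h : (forall t : R, spectrum A t%:C -> f t <= h.[t]) ->
  forall x, rd (B x) x <= rd (poly_op h A x) x.
Proof.
move=> hf x; rewrite -subr_le0.
apply: (@small _ (2 * rd x x)) => e e0.
have [_ /(_ e e0)[p [pf pB]]] := (is_fun_calcP _ _ _).1 fB.
have := @poly_op_le _ _ _ hdot (p - e%:P) h A Ab As _ x.
rewrite poly_opB poly_opC /= !fctE !rdotE => hp.
have {}hp : rd (poly_op p A x) x - e * rd x x <= rd (poly_op h A x) x.
  apply: hp => t St; apply: le_trans (hf t St); rewrite !hornerE.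
  have := pf t St; rewrite ler_norml => /andP[_ ?]; lra.
have := rdot_le_nrm dot (- (poly_op p A x - B x)) x; rewrite !rdotE nrmN.
have : nm (poly_op p A x - B x) * nm x <= e * rd x x.
  by rewrite -nrm_sqr expr2 mulrA ler_wpM2r ?nrm_ge0.
lra.
Qed.

(** For approximants [p] of [f] and [r] of [g], the polynomial [p r - q] is small on the spectrum,
    hence small in norm at [A]. This yields the cancellation rules for square roots of [X], where
    [q] is ['X] or 1. *)
Lemma fun_calc_mul g B' (q : {poly R}) (F E : R) : is_fun_calc g A B' ->
  (forall t : R, spectrum A t%:C -> `|f t| <= F) ->
  (forall t : R, spectrum A t%:C -> `|g t| <= E) ->
  (forall t : R, spectrum A t%:C -> f t * g t = q.[t]) ->
  forall x, B (B' x) = poly_op q A x.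
Proof.
move=> gB fF gE fg x; apply/eqP; rewrite -subr_eq0; apply/eqP; apply: (@nrm_le0 _ _ dot).
have /(bounded_opP hdot)[Bl [b b0 Bbd]] := Bb.
have /(bounded_opP hdot)[_ [b' b'0 B'b]] : bounded_op B' := gB.1.
apply: (@small _ ((`|F| + `|E| + 1) * nm x + ((b' + 1) * nm x + b * nm x))) => e e0.
(* The product of the two errors is of order [e^2]; for [e <= 1] it is absorbed into a term linear
   in [e]. *)
wlog e1 : e e0 / e <= 1 => [wl|].
  have [e1|/ltW e1] := leP e 1; first exact: wl.
  apply: (le_trans (wl 1 ltr01 (lexx _))); rewrite ler_wpM2r //.
  by rewrite addr_ge0 // ?addr_ge0 // mulr_ge0 ?nrm_ge0 ?addr_ge0 ?normr_ge0 // ltW.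
have [_ /(_ e e0)[p [pf pB]]] := (is_fun_calcP _ _ _).1 fB.
have [_ /(_ e e0)[r [rg rB]]] := (is_fun_calcP _ _ _).1 gB.
have K0 : 0 < `|F| + `|E| + 1.
  by rewrite ltr_wpDl // addr_ge0.
have hpq : nm (poly_op (p * r - q) A x) <= e * (`|F| + `|E| + 1) * nm x.
  move: x; apply/(opnorm_leP hdot); apply: (opnorm_poly_op hdot) => // [|t St].
    exact: mulr_gt0.
  rewrite hornerD hornerN hornerM -(fg t St).
  have -> : p.[t] * r.[t] - f t * g t =
    (p.[t] - f t) * (r.[t] - g t) + (p.[t] - f t) * g t + f t * (r.[t] - g t) by ring.
  apply: (le_trans (ler_normD _ _)).
  have h1 := ler_normD ((p.[t] - f t) * (r.[t] - g t)) ((p.[t] - f t) * g t).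
  have h2 : `|(p.[t] - f t) * (r.[t] - g t)| <= e * 1.
    by rewrite normrM ler_pM ?pf // (le_trans (rg t St)).
  have h3 : `|(p.[t] - f t) * g t| <= e * `|E|.
    by rewrite normrM ler_pM ?pf // (le_trans (gE t St)) // ler_norm.
  have h4 : `|f t * (r.[t] - g t)| <= e * `|F|.
    by rewrite mulrC normrM ler_pM ?rg // (le_trans (fF t St)) // ler_norm.
  lra.
have -> : B (B' x) - poly_op q A x = poly_op (p * r - q) A x
   - ((poly_op p A (poly_op r A x) - B (poly_op r A x)) + B (poly_op r A x - B' x)).
  have cancel (u v z : H) : (u - v) + (v - z) = u - z by rewrite addrA subrK.
  rewrite (linB Bl) cancel poly_opB (poly_opM _ _ Ab.1) !fctE /=.
  by rewrite opprB [RHS]addrC cancel.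
rewrite mulrDr mulrA; apply: (le_trans (nrmD hdot _ _)); apply: lerD => //.
rewrite nrmN mulrDr; apply: (le_trans (nrmD hdot _ _)); apply: lerD; last first.
  by apply: (le_trans (Bbd _)); rewrite mulrCA ler_pM2l.
apply: (le_trans (pB _)); rewrite ler_pM2l // mulrDl mul1r addrC.
rewrite -{1}(subrK (B' x) (poly_op r A x)); apply: (le_trans (nrmD hdot _ _)).
by apply: lerD => //; apply: (le_trans (rB x)); rewrite ler_piMl ?nrm_ge0.
Qed.

End SelfAdjoint.

End FunctionalCalculus.

(** * The positive cone and its means *)

Section PositiveCone.
Context {R : realType} {H : completeNormedModType R[i]}.
Variable dot : {dot H for (@Num.conj R[i])}.
Hypothesis hdot : hilbert_dot dot.
Implicit Types (x y : H) (A B X Y P Q S T : H -> H).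
Local Notation rd := (rdot dot).
Local Notation nm := (nrm dot).
Local Notation rsa := (rsa dot).

(** Coercivity passes easily through sums, positive multiples and congruences, and it keeps the
    spectrum away from 0, where powers and the logarithm lose their Lipschitz bounds. *)
Lemma pos_coneP X : pos_cone dot X <-> [/\ bounded_op X, rsa X &
  exists2 c : R, 0 < c & forall x, c * rd x x <= rd (X x) x].
Proof.
split=> [[/positive_opP[Xb Xs X0] Xi]|[Xb Xs [c c0 cX]]].
  by split=> //; exact: (invertible_coercive hdot).
split; last exact: (coercive_invertible hdot Xb Xs c0 cX).
apply/positive_opP; split=> // x.
by apply: le_trans (cX x); rewrite mulr_ge0 ?rdot_ge0 ?ltW.
Qed.

Lemma pos_cone_bounded X : pos_cone dot X -> bounded_op X.
Proof. by move=> /pos_coneP[]. Qed.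

Lemma pos_cone_rsa X : pos_cone dot X -> rsa X.
Proof. by move=> /pos_coneP[]. Qed.

Lemma pos_cone_ge0 X : pos_cone dot X -> forall x, 0 <= rd (X x) x.
Proof. by move=> [/positive_opP[]]. Qed.

Lemma pos_cone_spectrum X : pos_cone dot X -> exists c d : R,
  [/\ 0 < c, c < d & forall t : R, spectrum X t%:C -> c <= t <= d].
Proof.
move=> /pos_coneP[Xb Xs [c c0 cX]]; have [M M0 XM] := bounded_form hdot Xb.
(* The upper end [M + c] makes the interval nondegenerate, as [lipschitz_approx] requires. *)
exists c, (M + c); split=> //; first by rewrite ltrDr.
apply: (spectrum_form_bounds hdot) => // x; apply: (le_trans (ler_norm _)).
by apply: (le_trans (XM x)); rewrite ler_wpM2r ?rdot_ge0 // lerDl ltW.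
Qed.

Lemma op_powP X (r : R) : pos_cone dot X ->
  is_fun_calc (fun t => t `^ r) X (op_pow X r).
Proof.
move=> Xc; apply: (fun_calc_exists hdot (pos_cone_bounded Xc) (pos_cone_rsa Xc)).
move=> e e0; have [c [d [c0 cd Xcd]]] := pos_cone_spectrum Xc.
have [L L0 rL] := powR_lipschitz d r c0.
have [p pe] := lipschitz_approx cd L0 rL e0.
by exists p => t /Xcd; exact: pe.
Qed.

Lemma op_logP X : pos_cone dot X -> is_fun_calc (@ln R) X (op_log X).
Proof.
move=> Xc; apply: (fun_calc_exists hdot (pos_cone_bounded Xc) (pos_cone_rsa Xc)).
move=> e e0; have [c [d [c0 cd Xcd]]] := pos_cone_spectrum Xc.
have lnL (s t : R) : c <= s <= d -> c <= t <= d -> `|ln s - ln t| <= c^-1 * `|s - t|.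
  by move=> /andP[cs _] /andP[ct _]; exact: ln_lipschitz.
have ci : 0 <= c^-1 by rewrite invr_ge0 ltW.
have [p pe] := lipschitz_approx cd ci lnL e0.
by exists p => t /Xcd; exact: pe.
Qed.

Lemma op_pow_bounded_rsa X (r : R) : pos_cone dot X ->
  bounded_op (op_pow X r) /\ rsa (op_pow X r).
Proof.
move=> Xc; have Xr := op_powP r Xc; split; first exact: Xr.1.
exact: (fun_calc_rsa hdot (pos_cone_rsa Xc) Xr).
Qed.

Lemma op_pow_mul X (r s : R) (q : {poly R}) : pos_cone dot X ->
  (forall t : R, 0 < t -> t `^ (r + s) = q.[t]) ->
  forall x, op_pow X r (op_pow X s x) = poly_op q X x.
Proof.
move=> Xc rs; have [c [d [c0 cd Xcd]]] := pos_cone_spectrum Xc.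
have [E _ rE] := powR_bounded d r c0; have [F _ sF] := powR_bounded d s c0.
apply: (fun_calc_mul hdot (pos_cone_bounded Xc) (pos_cone_rsa Xc) (op_powP r Xc)
  (op_powP s Xc) (F := E) (E := F)) => t /Xcd ctd; [exact: rE|exact: sF|].
have t0 : 0 < t by case/andP: ctd; lra.
by rewrite -powRD ?rs // (gt_eqF t0) implybT.
Qed.

Lemma op_sqrtK X x : pos_cone dot X ->
  op_pow X (1 / 2) (op_pow X (1 / 2) x) = X x.
Proof.
move=> Xc; rewrite (op_pow_mul (q := 'X)) ?poly_opX // => t t0.
by rewrite hornerX -splitr powRr1 // ltW.
Qed.

Lemma op_sqrtKV X x : pos_cone dot X ->
  op_pow X (1 / 2) (op_pow X (- (1 / 2)) x) = x.
Proof.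
move=> Xc; rewrite (op_pow_mul (q := 1%:P)) ?poly_opC // => [|t t0].
  by rewrite fctE scale1r.
by rewrite hornerC subrr powRr0.
Qed.

Lemma op_sqrtVK X x : pos_cone dot X ->
  op_pow X (- (1 / 2)) (op_pow X (1 / 2) x) = x.
Proof.
move=> Xc; rewrite (op_pow_mul (q := 1%:P)) ?poly_opC // => [|t t0].
  by rewrite fctE scale1r.
by rewrite hornerC addrC subrr powRr0.
Qed.

(** The bounded left inverse [S] gives [|x| <= b |T x|], so [T] loses at most a factor [b^2] of
    coercivity. *)
Lemma pos_cone_conj X S T : pos_cone dot X -> bounded_op T -> rsa T ->
  bounded_op S -> (forall x, S (T x) = x) -> pos_cone dot (T \o X \o T).
Proof.
move=> /pos_coneP[Xb Xs [c c0 cX]] Tb Ts Sb ST; apply/pos_coneP; split.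
- exact: (bounded_comp hdot (bounded_comp hdot Tb Xb) Tb).
- by move=> x y; rewrite /= Ts Xs Ts.
have /(bounded_opP hdot)[_ [b b0 Sb']] := Sb.
exists (c / b ^+ 2); first by rewrite divr_gt0 ?exprn_gt0.
move=> x; rewrite /= Ts; apply: le_trans (cX (T x)); rewrite -mulrA ler_pM2l //.
rewrite ler_pdivrMl ?exprn_gt0 // -!nrm_sqr -exprMn.
by rewrite ler_pXn2r ?nnegrE ?nrm_ge0 ?mulr_ge0 ?(ltW b0) ?nrm_ge0 // -{1}(ST x).
Qed.

Lemma op_inv_unique A B : is_inverse A B -> op_inv A = B.
Proof.
move=> AB; apply: xget_unique => //= C [_ AC CA].
have [_ AB1 BA] := AB.
by apply/funext => x; rewrite -[LHS](congr1 (fun f => f (C x)) BA) /=;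
   have /= -> := congr1 (fun f => f x) AC.
Qed.

Lemma op_invP X : pos_cone dot X -> is_inverse X (op_inv X).
Proof. by move=> [_ Xi]; exact: xgetPex. Qed.

Lemma op_invK X x : pos_cone dot X -> X (op_inv X x) = x.
Proof. by move=> /op_invP[_ e _]; have /= -> := congr1 (fun f => f x) e. Qed.

Lemma op_inv_op X x : pos_cone dot X -> op_inv X (X x) = x.
Proof. by move=> /op_invP[_ _ e]; have /= -> := congr1 (fun f => f x) e. Qed.

Lemma pos_cone_inv X : pos_cone dot X -> pos_cone dot (op_inv X).
Proof.
move=> Xc; have [Xib XXi XiX] := op_invP Xc.
split; last by exists X; split=> //; exact: pos_cone_bounded.
apply/positive_opP; split=> // [x y|x].
  by rewrite -{1}(op_invK y Xc) -(pos_cone_rsa Xc) op_invK.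
by rewrite -{2}(op_invK x Xc) rdotC pos_cone_ge0.
Qed.

(** Handles the default value under the inverse taken for negative exponents. If [0] does have an
    inverse, [H] is trivial and that inverse is again [0]. *)
Lemma op_inv0 : op_inv (0 : H -> H) = 0.
Proof.
rewrite /op_inv; case: xgetP => // B -> [_ zB _].
by apply/funext => x; rewrite -[LHS](congr1 (fun f => f _) zB).
Qed.

Lemma pos_coneD X Y : pos_cone dot X -> pos_cone dot Y -> pos_cone dot (X + Y).
Proof.
move=> /pos_coneP[Xb Xs [c c0 cX]] Yc; apply/pos_coneP; split.
- by apply: (boundedD hdot) => //; exact: pos_cone_bounded.
- by move=> x y; rewrite !fctE !rdotE Xs (pos_cone_rsa Yc).
exists c => // x; rewrite fctE rdotDl; have := cX x; have := pos_cone_ge0 Yc x; lra.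
Qed.

Lemma pos_coneZ (a : R) X : 0 < a -> pos_cone dot X -> pos_cone dot (a%:C *: X).
Proof.
move=> a0 /pos_coneP[Xb Xs [c c0 cX]]; apply/pos_coneP; split.
- exact: boundedZ.
- by move=> x y; rewrite !fctE !rdotE Xs.
exists (a * c); first exact: mulr_gt0.
by move=> x; rewrite fctE rdotE -mulrA ler_pM2l.
Qed.

Lemma pos_cone_id : pos_cone dot idfun.
Proof.
apply/pos_coneP; split=> //; first exact: (bounded_id hdot).
by exists 1 => // x; rewrite mul1r.
Qed.

(** The index type is nonempty because an empty sum is the zero operator. *)
Lemma pos_cone_sum (k : nat) (F : 'I_k.+1 -> H -> H) :
  (forall j, pos_cone dot (F j)) -> pos_cone dot (\sum_j F j).
Proof.
elim: k F => [|k IH] F hF; first by rewrite big_ord1.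
by rewrite big_ord_recl; apply: pos_coneD => //; apply: IH.
Qed.

Lemma loewner_form P Q : loewner_le dot P Q -> forall x, rd (P x) x <= rd (Q x) x.
Proof.
move=> /positive_opP[_ _ h] x; rewrite -subr_ge0.
by have := h x; rewrite !fctE !rdotE.
Qed.

Lemma loewner_leP P Q : bounded_op P -> rsa P -> bounded_op Q -> rsa Q ->
  (forall x, rd (P x) x <= rd (Q x) x) -> loewner_le dot P Q.
Proof.
move=> Pb Ps Qb Qs PQ; apply/positive_opP; split.
- exact: (boundedB hdot).
- by move=> x y; rewrite !fctE !rdotE Ps Qs.
- by move=> x; rewrite !fctE !rdotE subr_ge0.
Qed.

End PositiveCone.

(** * Power and Karcher means below the arithmetic mean *)

Section MeanBounds.
Context {R : realType} {H : completeNormedModType R[i]}.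
Variable dot : {dot H for (@Num.conj R[i])}.
Hypothesis hdot : hilbert_dot dot.
Variables (k : nat) (lam : 'I_k -> R) (Xs : 'I_k -> H -> H).
Hypotheses (hlam : prob_vec lam) (hXs : forall i, pos_cone dot (Xs i)).
Implicit Types (x y : H) (X : H -> H).
Local Notation rd := (rdot dot).
Local Notation rsa := (rsa dot).

Let sum_form (F : 'I_k -> H -> H) x :
  rd ((\sum_i (lam i)%:C *: F i) x) x = \sum_i lam i * rd (F i x) x.
Proof.
by rewrite fct_sumE rdot_suml; apply: eq_bigr => i _; rewrite fctE rdotE.
Qed.

(* From [t^p <= (1 - p) + p t]. *)
Lemma power_mean_eq_le (p : R) X : 0 < p <= 1 -> pos_cone dot X ->
  X = \sum_(i < k) (lam i)%:C *: wgeo_mean p X (Xs i) ->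
  forall x, rd (X x) x <= \sum_i lam i * rd (Xs i x) x.
Proof.
move=> /andP[p0 p1] Xc Xeq x.
have [Sb Ss] := op_pow_bounded_rsa hdot (1 / 2) Xc.
have [Tb Ts] := op_pow_bounded_rsa hdot (- (1 / 2)) Xc.
have h i : rd (wgeo_mean p X (Xs i) x) x <= (1 - p) * rd (X x) x + p * rd (Xs i x) x.
  have Cc := pos_cone_conj hdot (hXs i) Tb Ts Sb (fun x => op_sqrtKV hdot x Xc).
  have [c [d [c0 cd Ccd]]] := pos_cone_spectrum hdot Cc.
  (* At [y] the form of the identity is [rd (X x) x], and the form of the conjugated operator is
     [rd (Xs i x) x] because the inverse square root returns [y] to [x]. *)
  rewrite /wgeo_mean /= Ss; set y := op_pow X (1 / 2) x.
  have := fun_calc_le hdot (pos_cone_bounded hdot Cc) (pos_cone_rsa hdot Cc)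
    (op_powP hdot p Cc) (h := (1 - p)%:P + p *: 'X) _ y.
  rewrite poly_opD poly_opC poly_opZ poly_opX !fctE !rdotE /= Ts.
  rewrite /y (op_sqrtVK hdot) // Ss (op_sqrtK hdot) // (rdotC dot x).
  apply=> t /Ccd /andP[ct _]; rewrite !hornerE.
  by apply: powR_le_affine; [rewrite ltW|lra].
have : rd (X x) x <= \sum_i lam i * ((1 - p) * rd (X x) x + p * rd (Xs i x) x).
  rewrite {1}Xeq sum_form; apply: ler_sum => i _.
  by rewrite ler_pM2l //; apply: hlam.1.
have -> : \sum_i lam i * ((1 - p) * rd (X x) x + p * rd (Xs i x) x) =
    (1 - p) * rd (X x) x + p * \sum_i lam i * rd (Xs i x) x.
  transitivity ((\sum_i lam i) * ((1 - p) * rd (X x) x) + p * \sum_i lam i * rd (Xs i x) x).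
    rewrite mulr_suml mulr_sumr -big_split /=; apply: eq_bigr => i _; ring.
  by rewrite hlam.2 mul1r.
(* Moving [(1 - p) * rd (X x) x] to the left leaves [p] times the claim. *)
by move=> h1; rewrite -(ler_pM2l p0); lra.
Qed.

(* From [t^p >= 1 + p (1 - 1 / t)], multiplied by [t^2] to stay polynomial. *)
Lemma power_mean_eq_ge (p : R) X : 0 < p <= 1 -> pos_cone dot X ->
  X = \sum_(i < k) (lam i)%:C *: wgeo_mean p X (op_inv (Xs i)) ->
  forall x, rd (op_inv X x) x <= \sum_i lam i * rd (Xs i x) x.
Proof.
move=> /andP[p0 p1] Xc Xeq z; pose x := op_inv X z.
have Xx : X x = z by rewrite /x (op_invK _ Xc).
have [Sb Ss] := op_pow_bounded_rsa hdot (1 / 2) Xc.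
have [Tb Ts] := op_pow_bounded_rsa hdot (- (1 / 2)) Xc.
set S := op_pow X (1 / 2) in Sb Ss; set T := op_pow X (- (1 / 2)) in Tb Ts.
have ST y : S (T y) = y by exact: op_sqrtKV.
have TS y : T (S y) = y by exact: op_sqrtVK.
have SS y : S (S y) = X y by exact: op_sqrtK.
have h i : (1 + p) * rd (X x) x - p * rd (Xs i z) z <= rd (wgeo_mean p X (op_inv (Xs i)) x) x.
  have Cc := pos_cone_conj hdot (pos_cone_inv hdot (hXs i)) Tb Ts Sb ST.
  have [c [d [c0 cd Ccd]]] := pos_cone_spectrum hdot Cc.
  rewrite /wgeo_mean /= -/S -/T Ss; set C := T \o _ \o _ in Cc Ccd *.
  (* This is the inverse of [C] applied to [S x], written out. With it the form of [C^2] at [v] is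
     [rd (X x) x], and that of [C] is [rd (Xs i z) z] since [S (S x) = X x = z]. *)
  pose v := S (Xs i (S (S x))).
  have Cv : C v = S x by rewrite /C /v /= TS (op_inv_op _ (hXs i)) TS.
  have := fun_calc_ge hdot (pos_cone_bounded hdot Cc) (pos_cone_rsa hdot Cc)
    (op_powP hdot p Cc) (s := 'X) (h := (1 + p) *: ('X * 'X) - p *: 'X) _ v.
  have Cl := (pos_cone_bounded hdot Cc).1.
  rewrite poly_opB !poly_opZ (poly_opM _ _ Cl) !poly_opX !fctE !rdotE /= Cv.
  rewrite (pos_cone_rsa hdot Cc) Cv -Ss SS {1}/v -(rdotC dot v) /v -Ss SS Xx.
  rewrite (pos_cone_rsa hdot Xc (Xs i _)) !SS Xx; apply=> t /Ccd /andP[ct _].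
  have t0 : 0 < t by lra.
  rewrite hornerX.
  have -> : ((1 + p) *: ('X * 'X) - p *: 'X).[t] = t ^+ 2 * (1 + p * (1 - t^-1)).
    by rewrite hornerD hornerN !hornerZ hornerM hornerX; field; rewrite gt_eqF.
  by rewrite ler_pM2l ?exprn_gt0 // powR_ge_inv // ltW.
have : \sum_i lam i * ((1 + p) * rd (X x) x - p * rd (Xs i z) z) <= rd (X x) x.
  rewrite {2}Xeq sum_form; apply: ler_sum => i _.
  by rewrite ler_pM2l //; apply: hlam.1.
have -> : \sum_i lam i * ((1 + p) * rd (X x) x - p * rd (Xs i z) z) =
    (1 + p) * rd (X x) x - p * \sum_i lam i * rd (Xs i z) z.
  transitivity ((\sum_i lam i) * ((1 + p) * rd (X x) x) - p * \sum_i lam i * rd (Xs i z) z).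
    rewrite mulr_suml mulr_sumr -sumrB /=; apply: eq_bigr => i _; ring.
  by rewrite hlam.2 mul1r.
rewrite Xx -/x (rdotC dot x z) => h1.
by rewrite -(ler_pM2l p0); lra.
Qed.

(* From [ln t >= 1 - 1 / t], multiplied by [t^2] to stay polynomial. *)
Lemma karcher_eq_le X : pos_cone dot X ->
  \sum_(i < k) (lam i)%:C *:
      op_log (op_pow X (1 / 2) \o op_inv (Xs i) \o op_pow X (1 / 2)) = 0 ->
  forall x, rd (X x) x <= \sum_i lam i * rd (Xs i x) x.
Proof.
move=> Xc Xeq z.
have [Sb Ss] := op_pow_bounded_rsa hdot (1 / 2) Xc.
have [Tb Ts] := op_pow_bounded_rsa hdot (- (1 / 2)) Xc.
set S := op_pow X (1 / 2) in Sb Ss Xeq; set T := op_pow X (- (1 / 2)) in Tb Ts.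
have ST y : S (T y) = y by exact: op_sqrtKV.
have TS y : T (S y) = y by exact: op_sqrtVK.
have SS y : S (S y) = X y by exact: op_sqrtK.
pose x := S z.
have h i : rd x x - rd (Xs i z) z <= rd (op_log (S \o op_inv (Xs i) \o S) x) x.
  have Cc := pos_cone_conj hdot (pos_cone_inv hdot (hXs i)) Sb Ss Tb TS.
  have [c [d [c0 cd Ccd]]] := pos_cone_spectrum hdot Cc.
  set C := S \o _ \o _ in Cc Ccd *.
  (* The preimage of [x] under [C]. As [x = S z], the form of [C] at [v] is [rd (Xs i z) z], while
     [rd x x] will become [rd (X z) z]. *)
  pose v := T (Xs i (T x)).
  have Cv : C v = x by rewrite /C /v /= ST (op_inv_op _ (hXs i)) ST.
  have := fun_calc_ge hdot (pos_cone_bounded hdot Cc) (pos_cone_rsa hdot Cc)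
    (op_logP hdot Cc) (s := 'X) (h := 'X * 'X - 'X) _ v.
  have Cl := (pos_cone_bounded hdot Cc).1.
  rewrite poly_opB (poly_opM _ _ Cl) !poly_opX !fctE !rdotE /= Cv.
  rewrite (pos_cone_rsa hdot Cc) Cv (rdotC dot x v) {1}/v Ts /x TS.
  apply=> t /Ccd /andP[ct _].
  have t0 : 0 < t by lra.
  rewrite hornerX.
  have -> : ('X * 'X - 'X).[t] = t ^+ 2 * (1 - t^-1).
    by rewrite hornerD hornerN hornerM hornerX; field; rewrite gt_eqF.
  by rewrite ler_pM2l ?exprn_gt0 // ln_ge_1BV.
have : \sum_i lam i * (rd x x - rd (Xs i z) z) <= 0.
  have h0 : rd ((\sum_(i < k) (lam i)%:C *: op_log (S \o op_inv (Xs i) \o S)) x) x = 0.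
    by rewrite Xeq rdot0l.
  rewrite -[leRHS]h0 sum_form; apply: ler_sum => i _.
  by rewrite ler_pM2l //; apply: hlam.1.
have -> : \sum_i lam i * (rd x x - rd (Xs i z) z) =
    rd x x - \sum_i lam i * rd (Xs i z) z.
  transitivity ((\sum_i lam i) * rd x x - \sum_i lam i * rd (Xs i z) z).
    by rewrite mulr_suml -sumrB; apply: eq_bigr => i _; rewrite mulrBr.
  by rewrite hlam.2 mul1r.
by rewrite subr_le0 {1 2}/x Ss SS rdotC.
Qed.

(* When an equation defining the mean has no solution the mean is the junk
   value [0], for which the bound holds trivially; so solvability is never
   needed. *)
Lemma power_mean_le_arith (p : R) : -1 <= p -> p <= 1 ->
  [/\ bounded_op (power_mean dot p lam Xs), rsa (power_mean dot p lam Xs) &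
   forall x, rd (power_mean dot p lam Xs x) x <= \sum_i lam i * rd (Xs i x) x].
Proof.
move=> pN1 p1.
have junk : [/\ bounded_op (0 : H -> H), rsa 0 &
    forall x, rd ((0 : H -> H) x) x <= \sum_i lam i * rd (Xs i x) x].
  split=> [|x y|x]; first exact: (bounded0 hdot).
    by rewrite !rdotE.
  rewrite rdot0l; apply: sumr_ge0 => i _; rewrite mulr_ge0 ?pos_cone_ge0 //.
  by rewrite ltW //; apply: hlam.1.
rewrite /power_mean; case: ifPn => [p0|]; last (rewrite -leNgt => p0; case: ifPn => [p0'|_]).
- rewrite /power_mean_pos; case: xgetP => [X _ /= [Xc Xeq]|_ //].
  split; [exact: (pos_cone_bounded hdot Xc)|exact: (pos_cone_rsa hdot Xc)|].
  by apply: power_mean_eq_le Xeq; rewrite ?p0.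
- rewrite /power_mean_pos; case: xgetP => [X _ /= [Xc Xeq]|_]; last by rewrite op_inv0.
  have Xic := pos_cone_inv hdot Xc.
  split; [exact: (pos_cone_bounded hdot Xic)|exact: (pos_cone_rsa hdot Xic)|].
  by apply: power_mean_eq_ge Xeq; rewrite // oppr_gt0 p0' lerNl.
rewrite /karcher_mean; case: xgetP => [X _ /= [Xc Xeq]|_ //].
split; [exact: (pos_cone_bounded hdot Xc)|exact: (pos_cone_rsa hdot Xc)|].
exact: karcher_eq_le.
Qed.

End MeanBounds.

(** * Monotonicity and concavity of the parameterized mean *)

Section OrderedMean.
Context {R : realType} {H : completeNormedModType R[i]}.
Variable dot : {dot H for (@Num.conj R[i])}.
Hypothesis hdot : hilbert_dot dot.
Variable G : forall n : nat, ('I_n -> R) -> ('I_n -> H -> H) -> H -> H.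
Hypothesis hG : ordered_mean dot G.
Variables (n : nat) (w : 'I_n -> R).
Hypothesis hw : prob_vec w.
Implicit Types (x y : H) (A B : 'I_n -> H -> H).
Local Notation rd := (rdot dot).
Local Notation cone := (pos_cone dot).

Lemma om_superadditive A B : (forall i, cone (A i)) -> (forall i, cone (B i)) ->
  forall x, rd (G w A x) x + rd (G w B x) x <= rd (G w (fun i => A i + B i) x) x.
Proof.
move=> hA hB x; have h0 : 0 <= 1 / 2 :> R by lra.
have h1 : 1 / 2 <= 1 :> R by lra.
have := loewner_form (om_concave hG hw hA hB h0 h1) x.
have -> : (fun i => (1 - 1 / 2)%:C *: A i + (1 / 2)%:C *: B i) =
          (fun i => (1 / 2)%:C *: (A i + B i)).
  apply/funext => i; rewrite scalerDr; congr (_%:C *: _ + _); lra.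
rewrite (om_homogeneous hG hw) //; last by move=> i; exact: pos_coneD.
rewrite !fctE !rdotE; lra.
Qed.

Lemma om_superadditive_sum (k : nat) (As : 'I_k.+1 -> 'I_n -> H -> H) :
  (forall j i, cone (As j i)) ->
  forall x, \sum_j rd (G w (As j) x) x <= rd (G w (fun i => \sum_j As j i) x) x.
Proof.
elim: k As => [|k IH] As hAs x.
  rewrite big_ord1; have -> // : (fun i => \sum_j As j i) = As ord0.
  by apply/funext => i; rewrite big_ord1.
rewrite big_ord_recl; have -> : (fun i => \sum_j As j i) =
  (fun i => As ord0 i + (fun i => \sum_(j < k.+1) As (lift ord0 j) i) i).
  by apply/funext => i; rewrite big_ord_recl.
apply: le_trans (om_superadditive _ _ x) => //.
  by rewrite lerD2l; exact: (IH (fun j => As (lift ord0 j))).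
by move=> i; apply: (pos_cone_sum hdot).
Qed.

(** The weights sum to 1, so the harmonic mean of copies of [a I] is [a I] itself and the harmonic
    bound applies. *)
Lemma om_scalar (a : R) : 0 < a ->
  forall x, a * rd x x <= rd (G w (fun=> a%:C *: idfun) x) x.
Proof.
move=> a0 x.
have ac : cone (a%:C *: idfun) by apply: (pos_coneZ hdot a0); exact: pos_cone_id.
have := loewner_form (om_harmonic_le hG hw (fun=> ac)) x.
have aC : a%:C != 0 by rewrite eq_complex /= eqxx andbT gt_eqF.
have invZ (b : R[i]) : b != 0 -> op_inv (b *: idfun : H -> H) = b^-1 *: idfun.
  move=> b0; apply: op_inv_unique; split.
  - by apply: boundedZ; exact: (bounded_id hdot).
  - by apply/funext => y; rewrite !fctE scalerA divff // scale1r.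
  - by apply/funext => y; rewrite !fctE scalerA mulVf // scale1r.
rewrite invZ // -scaler_suml -rmorph_sum hw.2 rmorph1 scale1r invZ ?invr_eq0 //.
by rewrite invrK fctE rdotE.
Qed.

Variable A : 'I_n -> H -> H.
Hypothesis hA : forall i, cone (A i).

Lemma shift_pos_cone (a : R) : 0 < a -> forall i, cone (A i + a%:C *: idfun).
Proof.
move=> a0 i; apply: (pos_coneD hdot) => //; apply: (pos_coneZ hdot a0).
exact: pos_cone_id.
Qed.

Lemma param_meanE (a : R) x : rd (param_mean G a w A x) x =
  rd (G w (fun i => A i + a%:C *: idfun) x) x - a * rd x x.
Proof. by rewrite /param_mean !fctE !rdotE. Qed.

(** Superadditivity and [om_scalar] give [G(A + a) - a >= G(A)], so a coercivity constant of [G(A)]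
    carries over. *)
Lemma param_mean_pos_cone (a : R) : 0 < a -> cone (param_mean G a w A).
Proof.
move=> a0; have Gc := om_pos hG hw (shift_pos_cone a0).
apply/(pos_coneP hdot); split.
- by apply: (bounded_shift hdot); exact: pos_cone_bounded Gc.
- by apply: rsa_shift; exact: pos_cone_rsa Gc.
have /(pos_coneP hdot)[_ _ [c c0 cG]] := om_pos hG hw hA.
exists c => // x; rewrite param_meanE.
have ac : cone (a%:C *: idfun) by apply: (pos_coneZ hdot a0); exact: pos_cone_id.
have := om_superadditive hA (fun=> ac) x; have := om_scalar a0 x; have := cG x.
lra.
Qed.

Lemma param_mean_homo (a b : R) : 0 < a -> a <= b ->
  forall x, rd (param_mean G a w A x) x <= rd (param_mean G b w A x) x.
Proof.
move=> a0; rewrite le_eqVlt => /orP[/eqP-> //|ab x].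
have ba : 0 < b - a by rewrite subr_gt0.
have bac : cone ((b - a)%:C *: idfun) by apply: (pos_coneZ hdot ba); exact: pos_cone_id.
have := om_superadditive (shift_pos_cone a0) (fun=> bac) x.
have -> : (fun i => A i + a%:C *: idfun + (b - a)%:C *: idfun) =
          (fun i => A i + b%:C *: idfun).
  by apply/funext => i; rewrite -addrA -scalerDl -rmorphD (addrC a) subrK.
have := om_scalar ba x; rewrite !param_meanE; lra.
Qed.

(** Superadditivity is applied to the tuples [lam j (A + mu j)], whose sum is [A] shifted by the
    mean of the [mu j]; homogeneity then extracts each [lam j]. The case [k = 0] is excluded by the
    weights summing to 1. *)
Lemma param_mean_jensen (k : nat) (lam mu : 'I_k -> R) : prob_vec lam ->
  (forall j, 0 < mu j) -> forall x,
  \sum_j lam j * rd (param_mean G (mu j) w A x) x <=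
  rd (param_mean G (\sum_j lam j * mu j) w A x) x.
Proof.
case: k lam mu => [|k] lam mu [l0 l1] mu0 x.
  by move: l1; rewrite big_ord0 => /esym/eqP; rewrite oner_eq0.
have hc j i : cone ((lam j)%:C *: (A i + (mu j)%:C *: idfun)).
  by apply: (pos_coneZ hdot) => //; exact: shift_pos_cone.
have := om_superadditive_sum hc x.
have -> : (fun i => \sum_j (lam j)%:C *: (A i + (mu j)%:C *: idfun)) =
          (fun i => A i + (\sum_j lam j * mu j)%:C *: idfun).
  apply/funext => i; under eq_bigr do rewrite scalerDr scalerA -rmorphM.
  by rewrite big_split -!scaler_suml -!rmorph_sum /= l1 rmorph1 scale1r.
rewrite param_meanE => h.
have -> : \sum_j lam j * rd (param_mean G (mu j) w A x) x =
    \sum_j rd (G w (fun i => (lam j)%:C *: (A i + (mu j)%:C *: idfun)) x) x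
    - (\sum_j lam j * mu j) * rd x x.
  rewrite mulr_suml -sumrB; apply: eq_bigr => j _.
  rewrite param_meanE (om_homogeneous hG hw) //; last exact: shift_pos_cone.
  by rewrite fctE rdotE; ring.
lra.
Qed.

End OrderedMean.

Theorem theorem4p6 (R : realType) (H : completeNormedModType R[i])
    (dot : {dot H for Num.conj}) (hdot : hilbert_dot dot)
    (G : forall n : nat, ('I_n -> R) -> ('I_n -> H -> H) -> H -> H)
    (hG : ordered_mean dot G)
    (n k : nat) (A : 'I_n -> H -> H) (hA : forall i, pos_cone dot (A i))
    (w : 'I_n -> R) (hw : prob_vec w)
    (lam : 'I_k -> R) (hlam : prob_vec lam)
    (mu : 'I_k -> R) (hmu : forall i, 0 < mu i)
    (p q : R) (hp : -1 <= p) (hp1 : p <= 1) (hq : 1 <= q) :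
  loewner_le dot
    (power_mean dot p lam (fun i => param_mean G (mu i) w A))
    (param_mean G (real_power_mean q lam mu) w A).
Proof.
have Gc j := param_mean_pos_cone hdot hG hw hA (hmu j).
have [Pb Ps Ple] := power_mean_le_arith hdot hlam Gc hp hp1.
have mle := mean_le_power_mean hq hlam hmu.
have m0 := mean_gt0 hlam hmu.
have Gq := param_mean_pos_cone hdot hG hw hA (lt_le_trans m0 mle).
apply: (loewner_leP hdot Pb Ps (pos_cone_bounded hdot Gq) (pos_cone_rsa hdot Gq)) => x.
apply: (le_trans (Ple x)).
apply: (le_trans (param_mean_jensen hdot hG hw hA hlam hmu x)).
exact: param_mean_homo.
Qed.
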